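(* Let $R$ be an (associative unital) ring, and let $n>1$ be an integer or $n=\infty$. Let $\mathrm{FP}_n\text{-}\mathrm{Inj}$ be the class of $\mathrm{FP}_n$-injective left $R$-modules and $\mathrm{FP}_n\text{-}\mathrm{Flat}$ the class of $\mathrm{FP}_n$-flat right $R$-modules. The following statements are equivalent. (1) The class ${}^{\bot}(\mathrm{FP}_n\text{-}\mathrm{Inj})$ is closed under pure quotients. (2) The pair $\big({}^{\bot}(\mathrm{FP}_n\text{-}\mathrm{Inj}),\,(\mathrm{FP}_n\text{-}\mathrm{Flat})^{\bot}\big)$ is a duality pair. If these conditions hold, then the class $\mathrm{FP}_n\text{-}\mathrm{Inj}$ is enveloping.
   Context: For an integer $n\ge 0$, a (left or right) module $M$ is finitely $n$-presented if there is an exact sequence $F_n\to\cdots\to F_1\to F_0\to M\to 0$ with every $F_i$ finitely generated projective; $\mathrm{FP}_n$ is the class of such modules, and $\mathrm{FP}_\infty$ is the class of modules lying in $\mathrm{FP}_n$ for all $n\ge0$. A left $R$-module $M$ is $\mathrm{FP}_n$-injective if $\mathrm{Ext}^1_R(F,M)=0$ for all left modules $F\in\mathrm{FP}_n$. A right $R$-module $N$ is $\mathrm{FP}_n$-flat if $\mathrm{Tor}_1^R(N,F)=0$ for all left modules $F\in\mathrm{FP}_n$. For a class $\mathcal X$ of modules (on a fixed side), ${}^\bot\mathcal X=\{Y:\mathrm{Ext}^1_R(Y,X)=0\ \forall X\in\mathcal X\}$ and $\mathcal X^\bot=\{Y:\mathrm{Ext}^1_R(X,Y)=0\ \forall X\in\mathcal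 X\}$, with $Y$ ranging over modules on the same side. The Pontryagin dual of a left module $M$ is the right module $M^+=\mathrm{Hom}_{\mathbb Z}(M,\mathbb Q/\mathbb Z)$. A pair $(\mathcal M,\mathcal C)$, with $\mathcal M$ a class of left modules and $\mathcal C$ a class of right modules, is a duality pair if: $M\in\mathcal M$ if and only if $M^+\in\mathcal C$; and $\mathcal C$ is closed under direct summands and finite direct sums. A class is closed under pure quotients if for every pure exact sequence $0\to A\to B\to C\to0$ with $B$ in the class, $C$ is in the class. An $\mathcal X$-preenvelope of $M$ is a map $\varphi\colon M\to X$ with $X\in\mathcal X$ such that every map $M\to X'$ with $X'\in\mathcal X$ factors through $\varphi$; it is an envelope if moreover every endomorphism $f$ of $X$ with $f\varphi=\varphi$ is an automorphism. $\mathcal X$ is enveloping if every module has an $\mathcal X$-envelope. *)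

(* Defs.v *)
(* Conventions.
   - Rings are [pzRingType]s: associative and unital, the zero ring included.
   - Left R-modules are [lmodType R]; right R-modules are [lmodType R^c], left
     modules over the converse ring, so that [(r : R^c) *: n] is n r.
   - Classes of modules are predicates [lmodType R -> Prop]. *)
From HB Require Import structures.
From mathcomp Require Import all_boot all_order all_algebra.
From mathcomp Require Import generic_quotient ring_quotient.
From mathcomp Require Import boolp functions.
From mathcomp.multinomials Require Import freeg.

Set Implicit Arguments.
Unset Strict Implicit.
Unset Printing Implicit Defensive.

Import GRing.Theory Num.Theory.
Local Open Scope ring_scope.
Local Open Scope quotient_scope.

Definition surjective (A B : Type) (f : A -> B) : Prop :=
  forall y, exists x, f x = y.

(* A -f-> B -g-> C is exact at B *)
Definition exact_at (A : Type) (B : Type) (C : zmodType)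
    (f : A -> B) (g : B -> C) : Prop :=
  forall y, g y = 0 <-> exists x, f x = y.

(* 0 -> A -f-> B -g-> C -> 0 is exact, f being additive *)
Definition short_exact (A B C : zmodType) (f : A -> B) (g : B -> C) : Prop :=
  [/\ injective f, exact_at f g & surjective g].

Section Modules.
Variable R : pzRingType.
Implicit Types M P : lmodType R.

Definition fin_gen M : Prop :=
  exists (k : nat) (x : 'I_k -> M),
    forall y : M, exists a : 'I_k -> R, y = \sum_(i < k) a i *: x i.

Definition projective P : Prop :=
  forall (A B : lmodType R) (g : {linear A -> B}) (f : {linear P -> B}),
    surjective g -> exists h : {linear P -> A}, forall x, g (h x) = f x.

Definition fg_projective P : Prop := fin_gen P /\ projective P.

(* Only F 0, ..., F n and the maps between them are constrained. *)
Definition FP (n : nat) M : Prop :=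
  exists (F : nat -> lmodType R) (d : forall i, {linear F i.+1 -> F i})
         (e : {linear F 0%N -> M}),
    [/\ forall i, (i <= n)%N -> fg_projective (F i),
        surjective e,
        (0 < n)%N -> exact_at (d 0%N) e
      & forall i, (i.+1 < n)%N -> exact_at (d i.+1) (d i)].

Record resolution M := Resolution {
  res_obj : nat -> lmodType R;
  res_d : forall i, {linear res_obj i.+1 -> res_obj i};
  res_aug : {linear res_obj 0%N -> M};
  res_projective : forall i, projective (res_obj i);
  res_surj : surjective res_aug;
  res_exact0 : exact_at (res_d 0%N) res_aug;
  res_exact : forall i, exact_at (res_d i.+1) (res_d i)
}.

(* Ext^1_R(Y, X) = 0: for projective resolutions P of Y, the complex
   Hom(P_0, X) -> Hom(P_1, X) -> Hom(P_2, X) is exact in the middle. The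
   homology does not depend on P, and a P exists by [resolution_exists]. *)
Definition Ext1_zero (Y X : lmodType R) : Prop :=
  forall (P : resolution Y) (f : {linear res_obj P 1%N -> X}),
    (forall z, f (res_d P 1%N z) = 0) ->
    exists g : {linear res_obj P 0%N -> X}, forall z, f z = g (res_d P 0%N z).

Definition lperp (X : lmodType R -> Prop) : lmodType R -> Prop :=
  fun Y => forall Z, X Z -> Ext1_zero Y Z.

Definition rperp (X : lmodType R -> Prop) : lmodType R -> Prop :=
  fun Y => forall Z, X Z -> Ext1_zero Z Y.

Definition direct_summand (A B : lmodType R) : Prop :=
  exists (C : lmodType R) (f : {linear (A * C)%type -> B}), bijective f.

Definition closed_summands (X : lmodType R -> Prop) : Prop :=
  forall A B, direct_summand A B -> X B -> X A.

(* S is the direct sum of the M i, with canonical injections u i. *)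
Definition is_direct_sum (k : nat) (M : 'I_k -> lmodType R) (S : lmodType R)
    (u : forall i, {linear M i -> S}) : Prop :=
  bijective (fun m : (forall i, M i) => \sum_(i < k) u i (m i)).

Definition closed_finite_sums (X : lmodType R -> Prop) : Prop :=
  forall (k : nat) (M : 'I_k -> lmodType R) (S : lmodType R)
         (u : forall i, {linear M i -> S}),
    is_direct_sum u -> (forall i, X (M i)) -> X S.

Definition preenvelope (X : lmodType R -> Prop) (M E : lmodType R)
    (phi : {linear M -> E}) : Prop :=
  X E /\
  forall (E' : lmodType R) (psi : {linear M -> E'}), X E' ->
    exists f : {linear E -> E'}, forall x, f (phi x) = psi x.

Definition envelope (X : lmodType R -> Prop) (M E : lmodType R)
    (phi : {linear M -> E}) : Prop :=
  preenvelope X phi /\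
  forall f : {linear E -> E}, (forall x, f (phi x) = phi x) -> bijective f.

Definition enveloping (X : lmodType R -> Prop) : Prop :=
  forall M : lmodType R, exists (E : lmodType R) (phi : {linear M -> E}),
    envelope X phi.

End Modules.

(* The free module on S: functions S -> R of finite support. [{freeg S / R}]
   would exclude the zero ring. *)
Section Free.
Variables (R : pzRingType) (S : Type).

Definition fsupp_on (s : seq {classic S}) (f : S -> R) : Prop :=
  forall x : {classic S}, x \notin s -> f x = 0.

Definition finsupp : pred (S -> R^o) := fun f => `[< exists s, fsupp_on s f >].

Lemma finsupp_submod : submod_closed finsupp.
Proof.
split; first by apply/asboolP; exists [::].
move=> a f g /asboolP[s fs] /asboolP[t gt]; apply/asboolP.
exists (s ++ t) => x; rewrite mem_cat negb_or => /andP[xs xt].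
have -> : (a *: f + g) x = (a : R) * f x + g x by [].
by rewrite fs// gt// mulr0 addr0.
Qed.

HB.instance Definition _ :=
  GRing.isSubmodClosed.Build R (S -> R^o) finsupp finsupp_submod.

Record free := Free { free_val :> S -> R^o; _ : free_val \in finsupp }.

HB.instance Definition _ := [isSub for free_val].
HB.instance Definition _ := [Choice of free by <:].
HB.instance Definition _ := [SubChoice_isSubLmodule of free by <:].

Lemma free_choice (f : free) : exists s, fsupp_on s f.
Proof. by have /asboolP := valP f. Qed.

Definition free_supp (f : free) : seq {classic S} :=
  undup (projT1 (cid (free_choice f))).

Lemma free_supp_uniq f : uniq (free_supp f). Proof. exact: undup_uniq. Qed.

Lemma free_suppP f : fsupp_on (free_supp f) f.
Proof.
by move=> x; rewrite mem_undup => xs; case: cid xs => /= s fs /fs.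
Qed.

Definition free_lift_fun (M : lmodType R) (m : S -> M) (f : free) : M :=
  \sum_(x <- free_supp f) (f x : R) *: m x.

Lemma free_liftE (M : lmodType R) (m : S -> M) (f : free) s :
  uniq s -> fsupp_on s f -> free_lift_fun m f = \sum_(x <- s) (f x : R) *: m x.
Proof.
move=> us fs; rewrite /free_lift_fun.
have red (t : seq {classic S}) : fsupp_on t f ->
    \sum_(x <- t) (f x : R) *: m x = \sum_(x <- t | f x != 0) (f x : R) *: m x.
  move=> _; rewrite [LHS](bigID (fun x => f x != 0)) /= [X in _ + X]big1 ?addr0//.
  by move=> x; rewrite negbK => /eqP ->; rewrite scale0r.
rewrite (red _ fs) (red _ (@free_suppP f)) -[LHS]big_filter -[RHS]big_filter.
apply: perm_big; apply: uniq_perm; rewrite ?filter_uniq ?free_supp_uniq//.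
have in_supp t x : fsupp_on t f -> f x != 0 -> x \in t.
  by move=> ft; apply: contraNT => /ft ->.
move=> x; rewrite !mem_filter; case: (boolP (f x != 0)) => //= fx.
by rewrite !in_supp//; exact: free_suppP.
Qed.

Lemma free_lift_linear (M : lmodType R) (m : S -> M) : linear (free_lift_fun m).
Proof.
move=> a f g; pose s := undup (free_supp f ++ free_supp g).
have us : uniq s by exact: undup_uniq.
have sub (h : free) : {subset free_supp h <= s} -> fsupp_on s h.
  by move=> hs x xs; apply: free_suppP; apply: contra xs => /hs.
have fs : fsupp_on s f.
  by apply: sub => x xf; rewrite mem_undup mem_cat xf.
have gs : fsupp_on s g.
  by apply: sub => x xg; rewrite mem_undup mem_cat xg orbT.
have fgs : fsupp_on s (a *: f + g).
  move=> x xs; have -> : (a *: f + g) x = a * f x + g x by [].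
  by rewrite fs// gs// mulr0 addr0.
rewrite (free_liftE m us fs) (free_liftE m us gs) (free_liftE m us fgs).
rewrite scaler_sumr -big_split; apply: eq_bigr => x _ /=.
transitivity ((a * (f x : R) + (g x : R)) *: m x); first by [].
by rewrite scalerDl scalerA.
Qed.

HB.instance Definition _ (M : lmodType R) (m : S -> M) :=
  GRing.isLinear.Build R free M *:%R (free_lift_fun m) (free_lift_linear m).

Definition free_lift (M : lmodType R) (m : S -> M) : {linear free -> M} :=
  free_lift_fun m.

Definition delta_fun (x : S) : S -> R^o :=
  fun y => ((y : {classic S}) == x)%:R.

Lemma delta_finsupp x : delta_fun x \in finsupp.
Proof.
apply/asboolP; exists [:: x : {classic S}] => y.
by rewrite inE /delta_fun => /negbTE ->.
Qed.

Definition delta (x : S) : free := Free (delta_finsupp x).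

Lemma free_lift_delta (M : lmodType R) (m : S -> M) x :
  free_lift m (delta x) = m x.
Proof.
rewrite /= (@free_liftE _ _ _ [:: x : {classic S}])//.
  by rewrite big_seq1 /= /delta_fun eqxx scale1r.
by move=> y; rewrite inE /= /delta_fun => /negbTE ->.
Qed.

Lemma free_sum (f : free) :
  f = \sum_(x <- free_supp f) (f x : R) *: delta x.
Proof.
apply/val_inj/funext => y /=.
have ev (s : seq {classic S}) : free_val (\sum_(x <- s) (f x : R) *: delta x) y =
    \sum_(x <- s) f x * delta_fun x y.
  elim: s => [|x s ih]; first by rewrite !big_nil.
  by rewrite !big_cons -ih.
rewrite ev; have [ys|ys] := boolP ((y : {classic S}) \in free_supp f).
  rewrite (bigD1_seq (y : {classic S})) ?free_supp_uniq//= big1 => [|x xy].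
    by rewrite addr0 /delta_fun eqxx mulr1.
  by rewrite /delta_fun eq_sym (negbTE xy) mulr0.
rewrite (free_suppP ys) big_seq big1// => x xs; rewrite /delta_fun.
by case: eqP => [yx|_]; [rewrite yx xs in ys|rewrite mulr0].
Qed.

Lemma free_ext (M : lmodType R) (f g : {linear free -> M}) :
  (forall x, f (delta x) = g (delta x)) -> forall z, f z = g z.
Proof.
move=> fg z; rewrite (free_sum z) !linear_sum.
by apply: eq_bigr => x _; rewrite !linearZ fg.
Qed.

Lemma free_projective : projective free.
Proof.
move=> A B g f gs; pose a x := projT1 (cid (gs (f (delta x)))).
exists (free_lift a); apply: (@free_ext B (g \o free_lift a)) => x /=.
by rewrite -/(free_lift a _) free_lift_delta /a; case: cid.
Qed.

End Free.

Section FreeResolution.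
Variables (R : pzRingType) (M : lmodType R).

Record stage := Stage {
  st_cod : lmodType R; st_dom : lmodType R; st_map : {linear st_dom -> st_cod} }.

Definition kernel (A B : lmodType R) (f : {linear A -> B}) : Type :=
  {x : A | f x = 0}.

Fixpoint free_stage (n : nat) : stage :=
  if n is m.+1 then
    let s := free_stage m in
    Stage (free_lift (fun k : kernel (st_map s) => sval k))
  else Stage (free_lift (@id M)).

Lemma free_lift_exact (A B : lmodType R) (f : {linear A -> B}) :
  exact_at (free_lift (fun k : kernel f => sval k)) f.
Proof.
move=> y; split=> [fy|[x <-]].
  by exists (delta _ (exist _ y fy : kernel f)); rewrite free_lift_delta.
pose z : {linear free R (kernel f) -> B} := \0.
apply: (@free_ext _ _ B (f \o free_lift _) z) => k /=.
by rewrite -/(free_lift _ _) free_lift_delta (svalP k).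
Qed.

Definition free_resolution : resolution M.
Proof.
refine (@Resolution R M (fun n => st_dom (free_stage n))
  (fun n => st_map (free_stage n.+1)) (st_map (free_stage 0)) _ _ _ _).
- by case=> [|n]; exact: free_projective.
- by move=> x; exists (delta _ x); rewrite free_lift_delta.
- exact: free_lift_exact.
- by move=> i; exact: free_lift_exact.
Defined.

Lemma resolution_exists : inhabited (resolution M).
Proof. exact: (inhabits free_resolution). Qed.

End FreeResolution.

(* The Pontryagin dual M^+ = Hom_Z(M, Q/Z) of a left module, a right module by
   (f r)(x) = f(r x). *)
Definition QZ : Type := Quotient.quot
  (GRing.ZmodClosed.clone rat (@Num.int_num_subdef rat) _).
HB.instance Definition _ := GRing.Zmodule.on QZ.

Section Dual.
Variables (R : pzRingType) (M : lmodType R).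

Definition additive_fun : pred (M -> QZ) := fun f => `[< zmod_morphism f >].

Lemma additive_fun_zmod : zmod_closed additive_fun.
Proof.
split; first by apply/asboolP => x y; rewrite subr0.
move=> f g /asboolP fD /asboolP gD; apply/asboolP => x y.
have -> z : (f - g) z = f z - g z by [].
by rewrite fD gD !opprD !opprK addrACA.
Qed.

HB.instance Definition _ :=
  GRing.isZmodClosed.Build (M -> QZ) additive_fun additive_fun_zmod.

Record dual := Dual { dual_val :> M -> QZ; _ : dual_val \in additive_fun }.

HB.instance Definition _ := [isSub for dual_val].
HB.instance Definition _ := [Choice of dual by <:].
HB.instance Definition _ := [SubChoice_isSubZmodule of dual by <:].

Lemma dual_zmod_morphism (f : dual) : zmod_morphism f.
Proof. by have /asboolP := valP f. Qed.

HB.instance Definition _ (f : dual) :=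
  GRing.isZmodMorphism.Build M QZ f (dual_zmod_morphism f).

Lemma dual_scale_subproof (r : R^c) (f : dual) :
  (fun x => f ((r : R) *: x)) \in additive_fun.
Proof. by apply/asboolP => x y; rewrite scalerBr dual_zmod_morphism. Qed.

Definition dual_scale (r : R^c) (f : dual) : dual :=
  Dual (dual_scale_subproof r f).

Lemma dual_scaleA a b f : dual_scale a (dual_scale b f) = dual_scale (a * b) f.
Proof. by apply/val_inj/funext => x /=; rewrite scalerA. Qed.

Lemma dual_scale1 : left_id 1 dual_scale.
Proof. by move=> f; apply/val_inj/funext => x /=; rewrite scale1r. Qed.

Lemma dual_scaleDr : right_distributive dual_scale +%R.
Proof. by move=> a f g; apply/val_inj/funext. Qed.

Lemma dual_scaleDl f : {morph dual_scale^~ f : a b / a + b}.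
Proof.
move=> a b; apply/val_inj/funext => x /=.
by rewrite (scalerDl x (a : R) (b : R)) raddfD.
Qed.

HB.instance Definition _ := GRing.Zmodule_isLmodule.Build R^c dual
  dual_scaleA dual_scale1 dual_scaleDr dual_scaleDl.

End Dual.

Section Tensor.
Variables (R : pzRingType) (N : lmodType R^c) (M : lmodType R).

Definition tgen (n : N) (x : M) : {freeg (N * M)%type / int} :=
  [freeg [:: (1, (n, x))]].

(* The subgroup of Z^(N x M) generated by the relators of N (x)_R M. *)
Inductive tensor_null : {freeg (N * M)%type / int} -> Prop :=
| TensorDl n n' x : tensor_null (tgen (n + n') x - (tgen n x + tgen n' x))
| TensorDr n x x' : tensor_null (tgen n (x + x') - (tgen n x + tgen n x'))
| TensorZ n (r : R) x :
    tensor_null (tgen ((r : R^c) *: n) x - tgen n (r *: x))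
| Tensor0 : tensor_null 0
| TensorB t u : tensor_null t -> tensor_null u -> tensor_null (t - u).

Definition tensor_nullb : pred {freeg (N * M)%type / int} :=
  fun t => `[< tensor_null t >].

Lemma tensor_null_zmod : zmod_closed tensor_nullb.
Proof.
split; first by apply/asboolP; exact: Tensor0.
by move=> t u /asboolP ht /asboolP hu; apply/asboolP; exact: TensorB.
Qed.

HB.instance Definition _ :=
  GRing.isZmodClosed.Build {freeg (N * M)%type / int} tensor_nullb tensor_null_zmod.

Definition tensor : Type := Quotient.quot
  (GRing.ZmodClosed.clone {freeg (N * M)%type / int} tensor_nullb _).
HB.instance Definition _ := ZmodQuotient.on tensor.

Definition tens (n : N) (x : M) : tensor := \pi_tensor (tgen n x).

End Tensor.

Section TensorTheory.
Variables (R : pzRingType) (N : lmodType R^c).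
Implicit Types M : lmodType R.

Lemma tensor_eqP M (t u : {freeg (N * M)%type / int}) :
  \pi_(tensor N M) t = \pi_(tensor N M) u <-> tensor_null (t - u).
Proof.
split=> [/eqP|h]; first by rewrite -Quotient.idealrBE => /asboolP.
by apply/eqP; rewrite -Quotient.idealrBE; apply/asboolP.
Qed.

Lemma pi_tensorB M (t u : {freeg (N * M)%type / int}) :
  \pi_(tensor N M) (t - u) = \pi t - \pi u.
Proof. exact: (pi_is_zmod_morphism (tensor N M)). Qed.

Lemma pi_tensorD M (t u : {freeg (N * M)%type / int}) :
  \pi_(tensor N M) (t + u) = \pi t + \pi u.
Proof. exact: raddfD. Qed.

Lemma tensDl M (n n' : N) (x : M) : tens (n + n') x = tens n x + tens n' x.
Proof. by rewrite -pi_tensorD; apply/tensor_eqP/TensorDl. Qed.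

Lemma tensDr M (n : N) (x x' : M) : tens n (x + x') = tens n x + tens n x'.
Proof. by rewrite -pi_tensorD; apply/tensor_eqP/TensorDr. Qed.

Lemma tensZ M (n : N) (r : R) (x : M) :
  tens ((r : R^c) *: n) x = tens n (r *: x).
Proof. exact/tensor_eqP/TensorZ. Qed.

(* N (x) f, computed on representatives; see [tensor_map_tens] and
   [tensor_map_zmod_morphism]. *)
Definition tensor_map_lift (M M' : lmodType R) (f : M -> M') :
    {freeg (N * M)%type / int} -> {freeg (N * M')%type / int} :=
  fglift (fun p => tgen p.1 (f p.2)).

Definition tensor_map (M M' : lmodType R) (f : {linear M -> M'})
    (t : tensor N M) : tensor N M' :=
  \pi_(tensor N M') (tensor_map_lift f (repr t)).

Lemma tensor_map_liftB M M' (f : M -> M') t u :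
  tensor_map_lift f (t - u) = tensor_map_lift f t - tensor_map_lift f u.
Proof. exact: (lift_is_additive (fun p => tgen p.1 (f p.2))). Qed.

Lemma tensor_map_liftD M M' (f : M -> M') t u :
  tensor_map_lift f (t + u) = tensor_map_lift f t + tensor_map_lift f u.
Proof.
have f0 : tensor_map_lift f 0 = 0 by rewrite -(subrr 0) tensor_map_liftB subrr.
by rewrite -[u in LHS]opprK tensor_map_liftB -[- u]sub0r tensor_map_liftB f0
  sub0r opprK.
Qed.

Lemma tensor_map_lift_tgen M M' (f : M -> M') n x :
  tensor_map_lift f (tgen n x) = tgen n (f x).
Proof. by rewrite /tensor_map_lift liftU scale1r. Qed.

Lemma tensor_map_null M M' (f : {linear M -> M'}) t :
  tensor_null t -> tensor_null (tensor_map_lift f t).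
Proof.
elim=> {t} [n n' x|n x x'|n r x||t u _ ht _ hu].
- by rewrite tensor_map_liftB tensor_map_liftD !tensor_map_lift_tgen;
    exact: TensorDl.
- rewrite tensor_map_liftB tensor_map_liftD !tensor_map_lift_tgen linearD.
  exact: TensorDr.
- rewrite tensor_map_liftB !tensor_map_lift_tgen linearZ; exact: TensorZ.
- by rewrite -(subrr 0) tensor_map_liftB subrr; exact: Tensor0.
- by rewrite tensor_map_liftB; exact: TensorB.
Qed.

Lemma tensor_map_pi M M' (f : {linear M -> M'}) t :
  tensor_map f (\pi t) = \pi_(tensor N M') (tensor_map_lift f t).
Proof.
apply/tensor_eqP; rewrite -tensor_map_liftB; apply: tensor_map_null.
by apply/tensor_eqP; rewrite reprK.
Qed.

Lemma tensor_map_tens M M' (f : {linear M -> M'}) (n : N) (x : M) :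
  tensor_map f (tens n x) = tens n (f x).
Proof. by rewrite tensor_map_pi tensor_map_lift_tgen. Qed.

Lemma tensor_map_zmod_morphism M M' (f : {linear M -> M'}) :
  zmod_morphism (tensor_map f).
Proof.
move=> t u; rewrite -[t]reprK -[u]reprK -pi_tensorB !tensor_map_pi.
by rewrite tensor_map_liftB pi_tensorB.
Qed.

End TensorTheory.

Section Classes.
Variable R : pzRingType.

(* Tor_1^R(N, F) = 0: for projective resolutions P of F, the complex
   N (x) P_2 -> N (x) P_1 -> N (x) P_0 is exact in the middle. *)
Definition Tor1_zero (N : lmodType R^c) (F : lmodType R) : Prop :=
  forall P : resolution F,
    exact_at (tensor_map (N := N) (res_d P 1%N)) (tensor_map (res_d P 0%N)).

Definition pure_exact (A B C : lmodType R)
    (f : {linear A -> B}) (g : {linear B -> C}) : Prop :=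
  short_exact f g /\
  forall N : lmodType R^c,
    short_exact (tensor_map (N := N) f) (tensor_map (N := N) g).

Definition closed_pure_quotients (X : lmodType R -> Prop) : Prop :=
  forall (A B C : lmodType R) (f : {linear A -> B}) (g : {linear B -> C}),
    pure_exact f g -> X B -> X C.

Definition duality_pair (X : lmodType R -> Prop) (Y : lmodType R^c -> Prop) :
    Prop :=
  [/\ forall M, X M <-> Y (dual M), closed_summands Y & closed_finite_sums Y].

End Classes.

Inductive enat := Fin of nat | Infty.

Definition gt1 (n : enat) : Prop := if n is Fin k then (1 < k)%N else True.

Definition FP_class (R : pzRingType) (n : enat) (M : lmodType R) : Prop :=
  if n is Fin k then FP k M else forall k, FP k M.

Definition FP_inj (R : pzRingType) (n : enat) (M : lmodType R) : Prop :=
  forall F : lmodType R, FP_class n F -> Ext1_zero F M.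

Definition FP_flat (R : pzRingType) (n : enat) (N : lmodType R^c) : Prop :=
  forall F : lmodType R, FP_class n F -> Tor1_zero N F.

(* Main.v *)
(* Write X for the FP_n-injective left modules, A for the left class ^perp X, and
   N^+ for character modules.
   Since n > 1, an FP_n module has a free presentation R^p -> R^m -> R^k, so that
   membership in X is solvability of finite linear systems. Hence X is closed
   under direct sums and locally split quotients, and K in X implies that K^++ is
   in X, that is, that K^+ is FP_n-flat. Adjoining solutions omega times gives
   special X-preenvelopes, and Salce's pushout gives special A-precovers.
   (2) => (1): the dual of a pure exact sequence splits.
   (1) => (2): M in A gives M^+ in FP_n-Flat^perp because Ext^1(M, N^+) and
   Ext^1(N, M^+) both vanish exactly when Tor_1(N, M) does. Conversely, take
   0 -> K -> L -> M -> 0 with K in X and L in A; K^+ is FP_n-flat, so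
   Ext^1(K^+, M^+) = 0 splits the dual sequence, the sequence is pure, and M is a
   pure quotient of L.
   Envelopes follow Enochs: A is closed under direct limits. Among endomorphisms
   f under M of a special preenvelope W, one has maximal kernel, since otherwise
   transfinite composition gives more kernels than W has subsets. The direct
   limit V of W -f-> W -f-> ... then has only injective endomorphisms under M, and
   a non-surjective one would by the same argument give too many images in V. *)
From HB Require Import structures.
From mathcomp Require Import all_boot all_order all_algebra.
From mathcomp Require Import generic_quotient ring_quotient.
From mathcomp Require Import boolp functions.
From mathcomp Require classical_sets wochoice.
From mathcomp.multinomials Require Import freeg.
Require Import Defs.

Set Implicit Arguments.
Unset Strict Implicit.
Unset Printing Implicit Defensive.

Import GRing.Theory Num.Theory.
Local Open Scope ring_scope.
Local Open Scope quotient_scope.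

(** * Submodules, quotients and direct sums *)

Section LinearMaps.
Variable R : pzRingType.
Implicit Types A B C S X : lmodType R.

Definition mklin A B (f : A -> B) (lf : linear f) : {linear A -> B} :=
  HB.pack f (GRing.isLinear.Build R A B *:%R f lf).

(* [g] is the composite [psi o sigma^-1 o h]. *)
Lemma linear_factor C B S X (sigma : {linear S -> B}) (psi : {linear S -> X})
    (h : {linear C -> B}) :
  (forall s, sigma s = 0 -> psi s = 0) ->
  (forall c, exists s, sigma s = h c) ->
  exists g : {linear C -> X}, forall c s, sigma s = h c -> g c = psi s.
Proof.
move=> ker im; pose s c := projT1 (cid (im c)).
have sE c : sigma (s c) = h c by rewrite /s; case: cid.
have wd c t : sigma t = h c -> psi (s c) = psi t.
  move=> tc; apply/eqP; rewrite -subr_eq0 -linearB ker// linearB/= sE tc.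
  exact: subrr.
have lin : linear (fun c => psi (s c)).
  by move=> a u v; rewrite -linearP; apply: wd; rewrite !linearP !sE.
by exists (mklin lin).
Qed.

Lemma factor_epi S B X (sigma : {linear S -> B}) (psi : {linear S -> X}) :
  surjective sigma -> (forall s, sigma s = 0 -> psi s = 0) ->
  exists g : {linear B -> X}, forall s, g (sigma s) = psi s.
Proof.
move=> surj ker.
have [//|g gE] := @linear_factor B B S X sigma psi idfun ker.
by exists g => s; apply: gE.
Qed.

Lemma factor_mono S B C (sigma : {linear S -> B}) (h : {linear C -> B}) :
  injective sigma -> (forall c, exists s, sigma s = h c) ->
  exists g : {linear C -> S}, forall c, sigma (g c) = h c.
Proof.
move=> inj im.
have [s s0|//|g gE] := @linear_factor C B S S sigma idfun h.
  by apply: inj; rewrite s0 linear0.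
exists g => c; have [s sc] := im c.
by rewrite (gE c s sc).
Qed.

Definition pairlin A B X (f : {linear A -> X}) (g : {linear B -> X}) :
  {linear (A * B)%type -> X} := (f \o fst) \+ (g \o snd).

End LinearMaps.

Section Submodules.
Variables (R : pzRingType) (M : lmodType R).

(** Kernels, images and colimit relations are described by propositions, so submodules are
    [Prop]-valued; [sm_in] is the boolean form that the algebraic structures expect. *)
Record submod := Submod {
  sm_pred :> M -> Prop;
  sm0 : sm_pred 0;
  smP : forall a x y, sm_pred x -> sm_pred y -> sm_pred (a *: x + y) }.

Variable U : submod.

Lemma smZ a x : U x -> U (a *: x).
Proof. by move=> Ux; rewrite -[_ *: _]addr0; apply: smP Ux _; apply: sm0. Qed.

Definition sm_in : pred M := fun x => `[< U x >].

Lemma sm_in_closed : submod_closed sm_in.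
Proof.
split; first by apply/asboolP; exact: sm0.
by move=> a x y /asboolP Ux /asboolP Uy; apply/asboolP; exact: smP.
Qed.

HB.instance Definition _ := GRing.isSubmodClosed.Build R M sm_in sm_in_closed.

Record subm := SubM { subm_val : M; _ : subm_val \in sm_in }.

HB.instance Definition _ := [isSub for subm_val].
HB.instance Definition _ := [Choice of subm by <:].
HB.instance Definition _ := [SubChoice_isSubLmodule of subm by <:].

(** Locked, like the other basic maps below, so that simplification does not unfold it. *)
Definition sinc : {linear subm -> M} := locked (val : {linear subm -> M}).

Lemma sincE u : sinc u = val u. Proof. by rewrite /sinc -lock. Qed.

Lemma sincP (u : subm) : U (sinc u).
Proof. by rewrite sincE; have /asboolP := valP u. Qed.

Lemma sinc_inj : injective sinc.
Proof. by move=> x y; rewrite !sincE; exact: val_inj. Qed.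

Lemma sinc_surj x : U x -> exists u, sinc u = x.
Proof. by move=> Ux; exists (SubM (introT (asboolP _) Ux)); rewrite sincE. Qed.

Definition quotm : Type := Quotient.quot (GRing.ZmodClosed.clone M sm_in _).
HB.instance Definition _ := ZmodQuotient.on quotm.

Lemma quotm_eqP (x y : M) : \pi_quotm x = \pi_quotm y <-> U (x - y).
Proof.
split=> [/eqP|h]; first by rewrite -Quotient.idealrBE => /asboolP.
by apply/eqP; rewrite -Quotient.idealrBE; apply/asboolP.
Qed.

Lemma quotm_piD (x y : M) : \pi_quotm (x + y) = \pi_quotm x + \pi_quotm y.
Proof. exact: raddfD. Qed.

(** The quotient is formed as an abelian group; scalars act on representatives, and [quotm_piZ]
    shows independence of the choice. *)
Definition quotm_scale (a : R) (q : quotm) : quotm := \pi_quotm (a *: repr q).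

Lemma quotm_piZ a x : quotm_scale a (\pi_quotm x) = \pi_quotm (a *: x).
Proof.
apply/quotm_eqP; rewrite -scalerBr; apply: smZ; apply/quotm_eqP.
by rewrite reprK.
Qed.

Lemma quotm_scaleA a b q : quotm_scale a (quotm_scale b q) = quotm_scale (a * b) q.
Proof. by elim/quotW: q => x; rewrite (quotm_piZ b) !quotm_piZ scalerA. Qed.

Lemma quotm_scale1 : left_id 1 quotm_scale.
Proof. by elim/quotW=> x; rewrite quotm_piZ scale1r. Qed.

Lemma quotm_scaleDr : right_distributive quotm_scale +%R.
Proof.
move=> a; elim/quotW=> x; elim/quotW=> y; rewrite -quotm_piD !quotm_piZ.
by rewrite scalerDr quotm_piD.
Qed.

Lemma quotm_scaleDl q : {morph quotm_scale^~ q : a b / a + b}.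
Proof. by elim/quotW: q => x a b /=; rewrite !quotm_piZ scalerDl quotm_piD. Qed.

HB.instance Definition _ := GRing.Zmodule_isLmodule.Build R quotm
  quotm_scaleA quotm_scale1 quotm_scaleDr quotm_scaleDl.

Lemma qpi_linear : linear (\pi_quotm : M -> quotm).
Proof.
move=> a x y; rewrite quotm_piD; congr (_ + _).
by rewrite -quotm_piZ.
Qed.

Definition qpi : {linear M -> quotm} := locked (mklin qpi_linear).

Lemma qpi_surj : surjective qpi.
Proof. by move=> q; exists (repr q); rewrite /qpi -lock /= reprK. Qed.

Lemma qpi0 x : qpi x = 0 <-> U x.
Proof. by rewrite -(linear0 qpi) -{2}[x]subr0 -quotm_eqP /qpi -lock. Qed.

End Submodules.

Section KernelImage.
Variables (R : pzRingType) (A B : lmodType R) (f : {linear A -> B}).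

Definition ker_sm : submod A.
Proof.
apply: (@Submod _ _ (fun x => f x = 0)); first exact: linear0.
by move=> a x y x0 y0; rewrite linearP x0 y0 scaler0 addr0.
Defined.

Definition im_sm : submod B.
Proof.
apply: (@Submod _ _ (fun y => exists x, f x = y)); first by exists 0; exact: linear0.
by move=> a _ _ [x <-] [y <-]; exists (a *: x + y); rewrite linearP.
Defined.

Lemma coker_exact : exact_at f (qpi im_sm).
Proof. by move=> y; rewrite qpi0. Qed.

Lemma ker_exact : exact_at (sinc ker_sm) f.
Proof.
move=> y; split=> [fy|[u <-]]; first by apply: (@sinc_surj _ _ ker_sm).
exact: (@sincP _ _ ker_sm).
Qed.

End KernelImage.

(** * Pushouts *)

Section Pushout.
Variables (R : pzRingType) (D P X : lmodType R).
Variables (a : {linear D -> P}) (f : {linear D -> X}).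
Hypothesis ker : forall d, a d = 0 -> f d = 0.

(** The quotient of X * P by the image of d |-> (- f d, a d). As [a] may have a kernel, hypothesis
    [ker] is what makes [u] injective. *)
Lemma pushout : exists (Q : lmodType R) (u : {linear X -> Q}) (v : {linear P -> Q}),
  [/\ injective u, forall d, v (a d) = u (f d),
      forall q, exists x p, q = u x + v p &
      forall x p, u x + v p = 0 -> exists d, x = - f d /\ p = a d].
Proof.
have hl : linear (fun d => (- f d, a d)) :> Prop.
  by move=> c x y; rewrite !linearP; congr (_, _); rewrite /= ?scalerN ?opprD ?scalerN.
pose U := im_sm (mklin hl); pose q := qpi U.
have ul : linear (fun x : X => q (x, 0)).
  by move=> c x y; rewrite -linearP; congr (q (_, _)); rewrite /= scaler0 addr0.
have vl : linear (fun p : P => q (0, p)).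
  by move=> c x y; rewrite -linearP; congr (q (_, _)); rewrite /= scaler0 addr0.
have uvE x p : mklin ul x + mklin vl p = q (x, p).
  transitivity (q (x, 0) + q (0, p)); first by [].
  by rewrite -linearD; congr (q (_, _)); rewrite ?addr0 ?add0r.
exists (quotm U), (mklin ul), (mklin vl); split.
- move=> x y xy; have : mklin ul (x - y) + mklin vl 0 = 0.
    by rewrite linearB xy subrr linear0 addr0.
  rewrite uvE => /qpi0 [d [fd ad]].
  by apply/eqP; rewrite -subr_eq0 -fd (ker ad) oppr0.
- move=> d; apply/eqP; rewrite -subr_eq0 -linearN addrC uvE; apply/eqP/qpi0.
  by exists d.
- move=> z; have [[x p] <-] := qpi_surj z.
  by exists x, p; rewrite uvE.
- move=> x p; rewrite uvE => /qpi0 [d [<- <-]].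
  by exists d.
Qed.

End Pushout.

(** * Products and direct sums of arbitrary families *)

Section DependentProduct.
Variables (R : pzRingType) (I : Type) (V : I -> lmodType R).

Definition dprod : Type := forall i, V i.

HB.instance Definition _ := gen_eqMixin dprod.
HB.instance Definition _ := gen_choiceMixin dprod.

Definition dprod_add (x y : dprod) : dprod := fun i => x i + y i.
Definition dprod_opp (x : dprod) : dprod := fun i => - x i.
Definition dprod_zero : dprod := fun i => 0.
Definition dprod_scale (a : R) (x : dprod) : dprod := fun i => a *: x i.

Lemma dprod_addA : associative dprod_add.
Proof. by move=> x y z; apply: functional_extensionality_dep => i; apply: addrA. Qed.
Lemma dprod_addC : commutative dprod_add.
Proof. by move=> x y; apply: functional_extensionality_dep => i; apply: addrC. Qed.
Lemma dprod_add0 : left_id dprod_zero dprod_add.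
Proof. by move=> x; apply: functional_extensionality_dep => i; apply: add0r. Qed.
Lemma dprod_addN : left_inverse dprod_zero dprod_opp dprod_add.
Proof. by move=> x; apply: functional_extensionality_dep => i; apply: addNr. Qed.

HB.instance Definition _ :=
  GRing.isZmodule.Build dprod dprod_addA dprod_addC dprod_add0 dprod_addN.

Lemma dprod_scaleA a b x : dprod_scale a (dprod_scale b x) = dprod_scale (a * b) x.
Proof. by apply: functional_extensionality_dep => i; apply: scalerA. Qed.
Lemma dprod_scale1 : left_id 1 dprod_scale.
Proof. by move=> x; apply: functional_extensionality_dep => i; apply: scale1r. Qed.
Lemma dprod_scaleDr : right_distributive dprod_scale +%R.
Proof. by move=> a x y; apply: functional_extensionality_dep => i; apply: scalerDr. Qed.
Lemma dprod_scaleDl x : {morph dprod_scale^~ x : a b / a + b}.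
Proof. by move=> a b; apply: functional_extensionality_dep => i; apply: scalerDl. Qed.

HB.instance Definition _ := GRing.Zmodule_isLmodule.Build R dprod
  dprod_scaleA dprod_scale1 dprod_scaleDr dprod_scaleDl.

End DependentProduct.

Section DirectSum.
Variables (R : pzRingType) (I : Type) (V : I -> lmodType R).

Definition supp_in (s : seq {classic I}) (x : dprod V) :=
  forall i : {classic I}, i \notin s -> x i = 0.

Definition dsum_sm : submod (dprod V).
Proof.
apply: (@Submod _ _ (fun x => exists s, supp_in s x)); first by exists [::].
move=> a x y [s sx] [t ty]; exists (s ++ t) => i; rewrite mem_cat negb_or.
by case/andP=> /sx xi /ty yi; rewrite -[LHS]/(a *: x i + y i) xi yi scaler0 addr0.
Defined.

Definition dsum := subm dsum_sm.

Lemma dpr_linear i : linear (fun x : dsum => val x i).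
Proof. by move=> a x y. Qed.

Definition dpr i : {linear dsum -> V i} := locked (mklin (@dpr_linear i)).

Lemma dprE i x : dpr i x = val x i. Proof. by rewrite /dpr -lock. Qed.

Lemma dsum_eqP (x y : dsum) : (forall i, dpr i x = dpr i y) -> x = y.
Proof.
move=> xy; apply/val_inj/functional_extensionality_dep => i.
by have := xy i; rewrite !dprE.
Qed.

(** Since the modules vary with the index, [v] has to be transported along a classically decided
    equation i = j. *)
Definition din_fun i (v : V i) : dprod V := fun j =>
  if pselect (i = j) is left e then ecast k (V k) e v else 0.

Lemma din_fun_diag i (v : V i) : din_fun v i = v.
Proof. by rewrite /din_fun; case: pselect => // e; rewrite (Prop_irrelevance e erefl). Qed.

Lemma din_fun_off i j (v : V i) : i <> j -> din_fun v j = 0.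
Proof. by rewrite /din_fun; case: pselect. Qed.

Lemma din_sm i (v : V i) : din_fun v \in sm_in dsum_sm.
Proof.
apply/asboolP; exists [:: i : {classic I}] => j; rewrite inE => ji.
by apply: din_fun_off => ij; rewrite -ij eqxx in ji.
Qed.

Lemma din_linear i : linear (fun v : V i => SubM (din_sm v)).
Proof.
move=> a x y; apply: dsum_eqP => j; rewrite linearP !dprE /=.
have [<-|ij] := pselect (i = j); first by rewrite !din_fun_diag.
by rewrite !din_fun_off// scaler0 addr0.
Qed.

Definition din i : {linear V i -> dsum} := locked (mklin (@din_linear i)).

Lemma dpr_din i v : dpr i (din i v) = v.
Proof. by rewrite dprE /din -lock; exact: din_fun_diag. Qed.

Lemma dpr_din_off i j v : i <> j -> dpr j (din i v) = 0.
Proof. by rewrite dprE /din -lock; exact: din_fun_off. Qed.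

Lemma dsum_decomp (x : dsum) (s : seq {classic I}) : uniq s ->
  (forall i : {classic I}, i \notin s -> dpr i x = 0) ->
  x = \sum_(i <- s) din i (dpr i x).
Proof.
move=> us sx; apply: dsum_eqP => j; rewrite linear_sum.
have [js|js] := boolP ((j : {classic I}) \in s).
  rewrite (bigD1_seq (j : {classic I}))// dpr_din big1 => [|i ij].
    exact: (esym (addr0 _)).
  by rewrite dpr_din_off// => e; rewrite e eqxx in ij.
rewrite sx// big_seq big1// => i si; rewrite dpr_din_off// => ij.
by rewrite -ij si in js.
Qed.

Lemma dsum_supp (x : dsum) : exists s : seq {classic I}, uniq s /\
  forall i : {classic I}, i \notin s -> dpr i x = 0.
Proof.
have /asboolP [s sx] := valP x; exists (undup s); split; first exact: undup_uniq.
by move=> i; rewrite mem_undup dprE => /sx.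
Qed.

Lemma dsum_ext (X : lmodType R) (f g : {linear dsum -> X}) :
  (forall i v, f (din i v) = g (din i v)) -> forall x, f x = g x.
Proof.
move=> fg x; have [s [us sx]] := dsum_supp x.
by rewrite (dsum_decomp us sx) !linear_sum; apply: eq_bigr.
Qed.

Section Lift.
Variables (X : lmodType R) (g : forall i, {linear V i -> X}).

(** The sum runs over a chosen support; by [dlift_funE] any duplicate-free list containing the
    support gives the same value. *)
Definition dlift_fun (x : dsum) : X :=
  \sum_(i <- projT1 (cid (dsum_supp x))) g i (dpr i x).

Lemma dlift_funE x (s : seq {classic I}) : uniq s ->
  (forall i : {classic I}, i \notin s -> dpr i x = 0) ->
  dlift_fun x = \sum_(i <- s) g i (dpr i x).
Proof.
rewrite /dlift_fun; case: cid => /= t [ut xt] us xs.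
rewrite (bigID (fun i : {classic I} => i \in s)) [RHS](bigID (fun i => i \in t)) /=.
rewrite [X in _ + X]big1 ?[X in _ = _ + X]big1 ?addr0; last 2 first.
- by move=> i /xt ->; rewrite linear0.
- by move=> i /xs ->; rewrite linear0.
rewrite -[LHS]big_filter -[RHS]big_filter; apply: perm_big.
apply: uniq_perm; rewrite ?filter_uniq// => i.
by rewrite !mem_filter andbC.
Qed.

Lemma dlift_linear : linear dlift_fun.
Proof.
move=> a x y; have [s [us xs]] := dsum_supp x; have [t [ut yt]] := dsum_supp y.
pose r := undup (s ++ t); have ur : uniq r by exact: undup_uniq.
have xr (i : {classic I}) : i \notin r -> dpr i x = 0.
  by rewrite mem_undup mem_cat negb_or => /andP[/xs].
have yr (i : {classic I}) : i \notin r -> dpr i y = 0.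
  by rewrite mem_undup mem_cat negb_or => /andP[_ /yt].
rewrite (dlift_funE ur xr) (dlift_funE ur yr) (@dlift_funE _ r)//; last first.
  by move=> i ir; rewrite linearP xr// yr// scaler0 addr0.
rewrite scaler_sumr -big_split; apply: eq_bigr => i _.
by rewrite !linearP.
Qed.

Definition dlift : {linear dsum -> X} := locked (mklin dlift_linear).

Lemma dliftE x : dlift x = dlift_fun x. Proof. by rewrite /dlift -lock. Qed.

Lemma dlift_din i v : dlift (din i v) = g i v.
Proof.
rewrite dliftE (@dlift_funE _ [:: i : {classic I}])// ?big_seq1 ?dpr_din// => j.
by rewrite inE => ji; rewrite dpr_din_off// => ij; rewrite -ij eqxx in ji.
Qed.

End Lift.

Lemma dsum_projective : (forall i, projective (V i)) -> projective dsum.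
Proof.
move=> proj A B p f psurj.
pose h i := projT1 (cid (proj i A B p (f \o din i) psurj)).
exists (dlift h); apply: (@dsum_ext _ (p \o dlift h)) => i v.
by rewrite -[LHS]/(p (dlift h (din i v))) dlift_din /h; case: cid.
Qed.

End DirectSum.

Arguments dpr {R I V} i.
Arguments din {R I V} i.

(** * Vanishing of Ext *)

Section Ext.
Variable R : pzRingType.
Implicit Types A B C D E P X Y Z : lmodType R.

(* Vanishing of Ext^1(Y, X) without reference to resolutions: [B] is arbitrary
   and [a] need not be injective. *)
Definition ext0 Y X : Prop :=
  forall D B (a : {linear D -> B}) (p : {linear B -> Y}),
    exact_at a p -> surjective p ->
    forall f : {linear D -> X}, (forall d, a d = 0 -> f d = 0) ->
    exists g : {linear B -> X}, forall d, g (a d) = f d.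

(** Projectivity lifts [q] to h : P -> B. Then [f] pulls back along [h] to [D], extends to g : P ->
    X by hypothesis, and (f, g) descends along the surjection (a, h) onto [B]. *)
Lemma ext0_pres D P Y X (a0 : {linear D -> P}) (q : {linear P -> Y}) :
  projective P -> exact_at a0 q -> surjective q ->
  (forall f : {linear D -> X}, (forall d, a0 d = 0 -> f d = 0) ->
    exists g : {linear P -> X}, forall d, g (a0 d) = f d) ->
  ext0 Y X.
Proof.
move=> projP ex0 surj0 ext D' B a p ex surj f kf.
have [h hE] := projP _ _ p q surj.
have im d : exists d', a d' = (h \o a0) d.
  by apply/ex; rewrite hE; apply/ex0; exists d.
have [f1 f1E] := linear_factor kf im.
have [d a0d|g gE] := ext f1.
  by rewrite (f1E d 0) ?linear0//= a0d linear0.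
pose s := pairlin a h; pose t := pairlin f g.
have ss : surjective s.
  move=> b; have [x qx] := surj0 (p b).
  have /ex [d ad] : p (b - h x) = 0 by rewrite linearB hE qx subrr.
  by exists (d, x); rewrite /= ad subrK.
have kt u : s u = 0 -> t u = 0.
  case: u => d x /= dx; have /ex0 [z zx] : q x = 0.
    have pa : p (a d) = 0 by apply/ex; exists d.
    by rewrite -hE -[h x](addKr (a d)) dx addr0 linearN pa oppr0.
  have -> : g x = - f d.
    rewrite -zx gE (f1E z (- d)) ?linearN//=.
    by rewrite zx -[h x](addKr (a d)) dx addr0.
  exact: subrr.
have [r rE] := factor_epi ss kt.
exists r => d; have := rE (d, 0).
by rewrite /= !linear0 !addr0.
Qed.

(** Exactness at P_1 makes vanishing on the image of P_2 the same as vanishing on the kernel of P_1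
    -> P_0. One direction uses only the free resolution, the other serves every resolution. *)
Lemma Ext1P Y X : Ext1_zero Y X <-> ext0 Y X.
Proof.
split=> [ext|ext P f fd].
  pose P := free_resolution Y.
  apply: (@ext0_pres _ _ Y X (res_d P 0) (res_aug P)).
  - exact: res_projective.
  - exact: res_exact0.
  - exact: res_surj.
  move=> f kf; have [z|g gE] := ext P f; last by exists g => d; rewrite gE.
  by apply: kf; apply/(@res_exact _ _ P 0); exists z.
have [|g gE] := ext _ _ (res_d P 0) (res_aug P) (@res_exact0 _ _ P) (@res_surj _ _ P) f.
  by move=> d /(@res_exact _ _ P 0) [z <-]; exact: fd.
by exists g => z; rewrite gE.
Qed.

(** The pushout of [a] along [f] is an extension of [Y] by [X]; a retraction of it composed with [v]
    extends [f]. *)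
Lemma ext0_split Y X :
  (forall E (j : {linear X -> E}) (p : {linear E -> Y}), short_exact j p ->
     exists r : {linear E -> X}, forall x, r (j x) = x) ->
  ext0 Y X.
Proof.
move=> split D B a p ex surj f kf.
have [Q [u [v [uinj vu gen rel]]]] := pushout kf.
have su : surjective (pairlin u v).
  by move=> q; have [x [b ->]] := gen q; exists (x, b).
have kp s : pairlin u v s = 0 -> p s.2 = 0.
  by case: s => x b /= /rel [d [_ ->]]; apply/ex; exists d.
have [pi piE] := @factor_epi _ _ _ _ (pairlin u v) (p \o snd) su kp.
have piv b : pi (v b) = p b.
  by have := piE (0, b); rewrite /= linear0 add0r.
have piu x : pi (u x) = 0.
  by have := piE (x, 0); rewrite /= !linear0 addr0.
have [|r rE] := split Q u pi; last first.
  by exists (r \o v) => d /=; rewrite vu rE.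
split=> // [q|y]; last by have [b <-] := surj y; exists (v b).
split=> [|[x <-]//]; have [x [b ->]] := gen q.
rewrite linearD piu piv add0r => /ex [d <-].
by exists (x + f d); rewrite linearD vu.
Qed.

(* The pullback [K] of [q] along [v] is an extension of [C] by [X * A]. A map
   [K -> X] extending the first projection cuts out the graph of [w]. *)
Lemma ext0_lifting A B C E Z X (i : {linear A -> B}) (p : {linear B -> C})
    (j : {linear X -> E}) (q : {linear E -> Z})
    (u : {linear A -> E}) (v : {linear B -> Z}) :
  ext0 C X -> short_exact i p -> short_exact j q ->
  (forall a, q (u a) = v (i a)) ->
  exists w : {linear B -> E}, (forall a, w (i a) = u a) /\ (forall b, q (w b) = v b).
Proof.
move=> ext [iinj ip psurj] [jinj jq qsurj] comm.
have dl : linear (fun s : (B * E)%type => v s.1 - q s.2) :> Prop.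
  by move=> a s t; rewrite /= !linearP /= scalerBr scalerN addrACA.
pose K := ker_sm (mklin dl).
have inK b e : v b = q e -> exists k, sinc K k = (b, e).
  by move=> be; apply: sinc_surj; rewrite /= be subrr.
have Kin k : v (sinc K k).1 = q (sinc K k).2.
  by apply/eqP; rewrite -subr_eq0; apply/eqP; exact: (@sincP _ _ K).
have hl : linear (fun s : (X * A)%type => (i s.2, u s.2 + j s.1)) :> Prop.
  by move=> a s t; congr (_, _); rewrite /= !linearP //= scalerDr addrACA.
(* [h] embeds X * A as the kernel of K -> B -> C. *)
have [h hE] : exists h : {linear (X * A)%type -> subm K}, forall s,
    sinc K (h s) = (i s.2, u s.2 + j s.1).
  apply: (@factor_mono _ _ _ _ (sinc K) (mklin hl)) => [|s]; first exact: sinc_inj.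
  apply: inK; rewrite linearD -comm [q (j _)](_ : _ = 0) ?addr0//.
  by apply/jq; exists s.1.
have [| |s h0|r rE] := @ext _ _ h (p \o (fst \o sinc K)) _ _ fst.
- move=> k; rewrite /=; split=> [/ip [a ia]|[s <-]]; last by rewrite hE; apply/ip; exists s.2.
  have /jq [x jx] : q ((sinc K k).2 - u a) = 0.
    by rewrite linearB -Kin comm -ia subrr.
  exists (x, a); apply: (@sinc_inj _ _ K); rewrite hE /= ia jx addrC subrK.
  by case: (sinc K k).
- move=> c; have [b <-] := psurj c; have [e eb] := qsurj (v b).
  by have [k kE] := inK b e (esym eb); exists k; rewrite /= kE.
- have := hE s; rewrite h0 linear0 => -[/esym i0].
  have -> : s.2 = 0 by apply: iinj; rewrite i0 linear0.
  rewrite linear0 add0r => /esym j0.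
  by apply: jinj; rewrite j0 linear0.
(* This map kills the kernel of K -> B, hence descends to [w]. *)
have fl : linear (fun k => (sinc K k).2 - j (r k)) :> Prop.
  by move=> a s t; rewrite /= !linearP /= scalerBr scalerN addrACA.
have [||w wE] := @factor_epi _ _ _ _ (fst \o sinc K) (mklin fl).
- move=> b; have [e eb] := qsurj (v b).
  by have [k kE] := inK b e (esym eb); exists k; rewrite /= kE.
- move=> k /= k1; have /jq [x jx] : q (sinc K k).2 = 0 by rewrite -Kin k1 linear0.
  have -> : k = h (x, 0).
    by apply: (@sinc_inj _ _ K); rewrite hE /= jx !linear0 add0r -k1; case: (sinc K k).
  by rewrite rE hE /= linear0 add0r subrr.
exists w; split=> [a|b].
  have := wE (h (0, a)); rewrite /= rE hE /= !linear0 ?oppr0 !addr0.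
  by move=> ->.
have [e eb] := qsurj (v b); have [k kE] := inK b e (esym eb).
have := wE k; rewrite /= kE /= => ->; rewrite linearB eb [q (j _)](_ : _ = 0) ?subr0//.
by apply/jq; exists (r k).
Qed.

(** [w] stands for a section of [p], given on a cover [c] of [C]. The map (j, w) is onto [E], and
    the first projection factors through it. *)
Lemma retract_of_section B C E X (c : {linear B -> C}) (j : {linear X -> E})
    (p : {linear E -> C}) (w : {linear B -> E}) :
  surjective c -> short_exact j p -> (forall b, p (w b) = c b) ->
  (forall b, c b = 0 -> w b = 0) ->
  exists r : {linear E -> X}, forall x, r (j x) = x.
Proof.
move=> csurj [jinj jp psurj] pw cw.
have pj x : p (j x) = 0 by apply/jp; exists x.
have [||r rE] := @factor_epi _ _ _ _ (pairlin j w) fst.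
- move=> e; have [b cb] := csurj (p e).
  have /jp [x jx] : p (e - w b) = 0 by rewrite linearB pw cb subrr.
  by exists (x, b); rewrite /= jx subrK.
- move=> [x b] /= jw.
  have cb : c b = 0 by rewrite -pw -[LHS]add0r -(pj x) -linearD jw linear0.
  by apply: jinj; rewrite -[LHS]addr0 -(cw b cb) jw linear0.
by exists r => x; have := rE (x, 0); rewrite /= linear0 addr0.
Qed.

(** In an extension of [B] by [X], [i] lifts because [A] is projective, and the lift extends over
    [B] to a section because Ext^1(C, X) = 0. *)
Lemma ext0_extension A B C X (i : {linear A -> B}) (p : {linear B -> C}) :
  short_exact i p -> projective A -> ext0 C X -> ext0 B X.
Proof.
move=> sip projA extC; apply: ext0_split => E j q sq; have [_ _ qsurj] := sq.
have [u uE] := projA _ _ q i qsurj.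
have [w [_ wE]] := @ext0_lifting _ _ _ _ _ _ i p j q u idfun extC sip sq uE.
apply: (@retract_of_section B B E X idfun j q w) => // [y|b /= ->].
  by exists y.
exact: linear0.
Qed.

End Ext.

(** * Free presentations *)

Section Rows.
Variable R : pzRingType.
Implicit Types M X : lmodType R.

Definition rdelta k (i : 'I_k) : 'rV[R]_k := delta_mx 0 i.

Lemma rv_ext k M (f g : {linear 'rV[R]_k -> M}) :
  (forall i, f (rdelta i) = g (rdelta i)) -> forall u, f u = g u.
Proof.
move=> fg u; rewrite (row_sum_delta u) !linear_sum.
by apply: eq_bigr => i _; rewrite !linearZ [f _]fg.
Qed.

Section Lift.
Variables (k : nat) (M : lmodType R) (x : 'I_k -> M).

Lemma rvlift_linear : linear (fun u : 'rV[R]_k => \sum_i u 0 i *: x i).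
Proof.
move=> a u v; rewrite scaler_sumr -big_split; apply: eq_bigr => i _ /=.
by rewrite !mxE scalerDl scalerA.
Qed.

Definition rvlift : {linear 'rV[R]_k -> M} := locked (mklin rvlift_linear).

Lemma rvliftE u : rvlift u = \sum_i u 0 i *: x i.
Proof. by rewrite /rvlift -lock. Qed.

Lemma rvlift_delta i : rvlift (rdelta i) = x i.
Proof.
rewrite rvliftE (bigD1 i)//= big1 => [|j ji].
  by rewrite mxE !eqxx scale1r addr0.
by rewrite mxE (negbTE ji) andbF scale0r.
Qed.

End Lift.

Lemma rv_projective k : projective 'rV[R]_k.
Proof.
move=> A B g f gs; pose a i := projT1 (cid (gs (f (rdelta i)))).
exists (rvlift a); apply: (@rv_ext k B (g \o rvlift a)) => i /=.
by rewrite rvlift_delta /a; case: cid.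
Qed.

Lemma fin_gen_rv M : fin_gen M -> exists k (q : {linear 'rV[R]_k -> M}), surjective q.
Proof.
move=> [k [x xgen]]; exists k, (rvlift x) => y; have [a ->] := xgen y.
by exists (\row_i a i); rewrite rvliftE; apply: eq_bigr => i _; rewrite mxE.
Qed.

Lemma fg_projective_rv M : fg_projective M ->
  exists k (q : {linear 'rV[R]_k -> M}) (s : {linear M -> 'rV[R]_k}),
    forall x, q (s x) = x.
Proof.
move=> [/fin_gen_rv [k [q qs]] proj].
by have [s sE] := proj _ _ q idfun qs; exists k, q, s.
Qed.

(** The two exactness conditions are just enough to express Ext^1(F, X) = 0 by finite linear systems
    over [X]. *)
Record free_pres (F : lmodType R) := FreePres {
  fr_k : nat; fr_m : nat; fr_p : nat;
  fr_q : {linear 'rV[R]_fr_k -> F};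
  fr_a : {linear 'rV[R]_fr_m -> 'rV[R]_fr_k};
  fr_b : {linear 'rV[R]_fr_p -> 'rV[R]_fr_m};
  fr_surj : surjective fr_q;
  fr_ex0 : exact_at fr_a fr_q;
  fr_ex1 : exact_at fr_b fr_a }.

(* Each projective is completed to a free module by adding a complement in two
   consecutive degrees. *)
Lemma FP_free_pres n (F : lmodType R) : gt1 n -> FP_class n F -> inhabited (free_pres F).
Proof.
move=> n1 FPF.
(* For infinite [n], the index 2 serves. *)
have [k k1 [P [d [e [fgP esurj]]]]] : exists2 k, (1 < k)%N & FP k F.
  by case: n n1 FPF => [k|] /= k1 FPk; [exists k|exists 2].
move=> /(_ (ltnW k1)) ex0 /(_ 0 k1) ex1.
have [k0 [q0 [s0 s0E]]] := fg_projective_rv (fgP 0 isT).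
have [k2 [q1 [s1 s1E]]] := fg_projective_rv (fgP 1 (ltnW k1)).
have [/fin_gen_rv [k3 [q2 q2surj]] _] := fgP 2 k1.
(* The map 1 - s0 q0 projects onto ker q0, the complement of P 0, which [e \o q0] kills and this map
   must therefore reach. *)
have al : linear (fun w : 'rV[R]_(k2 + k0) =>
    s0 (d 0 (q1 (lsubmx w))) + (rsubmx w - s0 (q0 (rsubmx w)))) :> Prop.
  move=> a u v; rewrite !linearP /= !scalerDr [RHS]addrACA; congr (_ + _).
  exact: addrACA.
(* The kernel of the previous map also contains ker q1 and the copy of P 0 in the second summand;
   the last two blocks reach these. *)
have bl : linear (fun w : 'rV[R]_(k3 + (k2 + k0)) =>
    row_mx (s1 (d 1 (q2 (lsubmx w))) +
            (lsubmx (rsubmx w) - s1 (q1 (lsubmx (rsubmx w)))))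
      (s0 (q0 (rsubmx (rsubmx w))))) :> Prop.
  move=> a u v; rewrite !linearP /= scale_row_mx add_row_mx; congr row_mx.
  rewrite !scalerDr [RHS]addrACA; congr (_ + _).
  exact: addrACA.
split; refine (@FreePres F _ _ _ (e \o q0) (mklin al) (mklin bl) _ _ _).
- by move=> y; have [x <-] := esurj y; exists (s0 x); rewrite /= s0E.
- move=> y; split=> [/ex0 [z zy]|[w <-]] /=; last first.
    rewrite !linearD !linearN /= !s0E subrr addr0.
    by apply/ex0; exists (q1 (lsubmx w)).
  exists (row_mx (s1 z) y); rewrite /= row_mxKl row_mxKr s1E zy.
  by rewrite addrC subrK.
- move=> y; split=> [/= y0|[w <-]] /=; last first.
    rewrite row_mxKl row_mxKr !linearD !linearN /= !s1E subrr addr0 !s0E subrr addr0.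
    rewrite [d 0 _](_ : _ = 0) ?linear0//.
    by apply/ex1; exists (q2 (lsubmx w)).
  have dy : d 0 (q1 (lsubmx y)) = 0.
    by have := congr1 q0 y0; rewrite linear0 !linearD linearN /= !s0E subrr addr0.
  move: y0; rewrite dy linear0 add0r => /eqP; rewrite subr_eq0 => /eqP y0.
  have /ex1 [z zy] := dy; have [w wz] := q2surj z.
  exists (row_mx w y).
  by rewrite /= !row_mxKl !row_mxKr wz zy addrC subrK -y0 hsubmxK.
Qed.

(** By [fr_ex1], a map vanishes on the kernel of [fr_a] exactly when it kills the finitely many
    relations given by [fr_b]. *)
Lemma ext0_free_pres F X (P : free_pres F) :
  ext0 F X <-> (forall f : {linear 'rV[R]_(fr_m P) -> X},
     (forall z, f (fr_b P z) = 0) ->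
     exists g : {linear 'rV[R]_(fr_k P) -> X}, forall u, g (fr_a P u) = f u).
Proof.
split=> [ext f fb|ext].
  have [|d /(@fr_ex1 _ P) [z <-]//|g gE] := ext _ _ _ _ (@fr_ex0 _ P) _ f.
    exact: fr_surj.
  by exists g.
apply: (@ext0_pres _ _ _ _ _ (fr_a P) (fr_q P)).
- exact: rv_projective.
- exact: fr_ex0.
- exact: fr_surj.
move=> f kf; apply: ext => z; apply: kf; apply/(@fr_ex1 _ P).
by exists z.
Qed.

(* Every finite subset of the kernel is fixed by an endomorphism with values in
   the kernel; this implies purity, and holds for direct limits. *)
Definition locally_split_epi (B C : lmodType R) (g : {linear B -> C}) : Prop :=
  surjective g /\
  forall k (x : 'I_k -> B), (forall i, g (x i) = 0) ->
  exists r : {linear B -> B}, (forall b, g (r b) = 0) /\ forall i, r (x i) = x i.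

(** Lift [f] to h : R^m -> B. The finitely many values of [h] on the relations lie in ker g and are
    fixed by some [r], so h - r h is a cocycle in [B] that still lifts [f]. *)
Lemma ext0_locally_split F (P : free_pres F) (B C : lmodType R) (g : {linear B -> C}) :
  locally_split_epi g -> ext0 F B -> ext0 F C.
Proof.
move=> [gs gsp] /(ext0_free_pres _ P) ext; apply/(ext0_free_pres _ P) => f fb.
have [h hE] := @rv_projective _ _ _ g f gs.
have [|r [gr rE]] := gsp _ (fun i => h (fr_b P (rdelta i))).
  by move=> i; rewrite hE.
have [z|g' g'E] := ext (h \- (r \o h)).
  apply: (@rv_ext _ _ ((h \- (r \o h)) \o fr_b P) \0) => i /=.
  by rewrite rE subrr.
exists (g \o g') => u /=; rewrite g'E /= linearB gr subr0.
exact: hE.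
Qed.

(** The values of [f] on a basis have a finite joint support [t], so it is enough to solve in the
    coordinates of [t]. *)
Lemma ext0_dsum F (P : free_pres F) (I : Type) (V : I -> lmodType R) :
  (forall i, ext0 F (V i)) -> ext0 F (dsum V).
Proof.
move=> ext; apply/(ext0_free_pres _ P) => f fb.
have extV i : exists g : {linear 'rV[R]_(fr_k P) -> V i},
    forall u, g (fr_a P u) = dpr i (f u).
  have /(ext0_free_pres _ P)/(_ (dpr i \o f)) := ext i.
  by apply=> z /=; rewrite fb linear0.
have [s sP] := choice (fun l => dsum_supp (f (rdelta l))).
pose t := undup (flatten [seq s l | l <- enum 'I_(fr_m P)]).
have ut : uniq t by exact: undup_uniq.
have gl : linear (fun u => \sum_(i <- t) din i (projT1 (cid (extV i)) u)) :> Prop.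
  move=> c u v; rewrite scaler_sumr -big_split; apply: eq_bigr => i _.
  by rewrite !linearP.
exists (mklin gl).
apply: (@rv_ext _ _ (mklin gl \o fr_a P)) => l /=.
rewrite [RHS](dsum_decomp ut) => [|i it].
  by apply: eq_bigr => i _; case: cid => /= g ->.
have [_ ->//] := sP l; apply: contra it => is_; rewrite mem_undup.
by apply/flattenP; exists (s l) => //; apply/mapP; exists l; rewrite ?mem_enum.
Qed.

End Rows.

Arguments rdelta {R k} i.

(** * Direct limits *)

Section Colimit.
Variables (R : pzRingType) (I : Type) (le : I -> I -> Prop).
Hypothesis le_refl : forall i, le i i.
Hypothesis le_trans : forall i j k, le i j -> le j k -> le i k.
Hypothesis le_directed : forall i j, exists k, le i k /\ le j k.
Variable i0 : I.
(** A transition map is given for every pair; composition is constrained only along [le]. *)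
Variables (V : I -> lmodType R) (f : forall i j, {linear V i -> V j}).
Hypothesis f_id : forall i x, f i i x = x.
Hypothesis f_comp : forall i j k x, le i j -> le j k -> f j k (f i j x) = f i k x.

(** An elementwise form of the direct limit; the universal property follows in [colimit_univ]. *)
Definition is_colimit (L : lmodType R) (u : forall i, {linear V i -> L}) : Prop :=
  [/\ forall i j x, le i j -> u j (f i j x) = u i x,
      forall z, exists i x, z = u i x &
      forall i x, u i x = 0 -> exists j, le i j /\ f i j x = 0].

(** For such [j], pushing [x] to stage [j] uses only maps along [le]. *)
Definition below (x : dsum V) (j : I) := forall i, dpr i x <> 0 -> le i j.

Lemma upper_bound_seq (s : seq {classic I}) : exists j, forall i, i \in s -> le i j.
Proof.
elim: s => [|a s [j sj]]; first by exists i0.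
have [k [ak jk]] := le_directed a j; exists k => i; rewrite inE => /orP[/eqP ->//|/sj ij].
exact: le_trans jk.
Qed.

Lemma below_exists x : exists j, below x j.
Proof.
have [s [_ xs]] := dsum_supp x; have [j sj] := upper_bound_seq s.
exists j => i xi; apply: sj; apply: contrapT => /negP /xs.
exact: xi.
Qed.

Lemma belowW x i j : below x i -> le i j -> below x j.
Proof. by move=> xi ij k /xi ki; apply: le_trans ij. Qed.

Lemma dlift_congr (X : lmodType R) (g h : forall i, {linear V i -> X}) x :
  (forall i, dpr i x <> 0 -> g i (dpr i x) = h i (dpr i x)) ->
  dlift g x = dlift h x.
Proof.
move=> gh; have [s [us sx]] := dsum_supp x.
rewrite !dliftE !(dlift_funE _ us sx); apply: eq_bigr => i _.
by have [->|/gh] := pselect (dpr i x = 0); rewrite ?linear0.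
Qed.

Lemma dlift_comp (X Y : lmodType R) (h : {linear X -> Y})
    (g : forall i, {linear V i -> X}) (g' : forall i, {linear V i -> Y}) x :
  (forall i, dpr i x <> 0 -> h (g i (dpr i x)) = g' i (dpr i x)) ->
  h (dlift g x) = dlift g' x.
Proof.
move=> hg; transitivity (dlift (fun i => (h \o g i : {linear V i -> Y})) x).
  apply: (@dsum_ext _ _ _ _ (h \o dlift g) (dlift _)) => i v /=.
  by rewrite !dlift_din.
exact: dlift_congr.
Qed.

Definition push j : {linear dsum V -> V j} := dlift (fun i => f i j).

Lemma push_push x i j : below x i -> le i j -> f i j (push i x) = push j x.
Proof. by move=> xi ij; apply: dlift_comp => k /xi ki; apply: f_comp. Qed.

(** The relations are the elements that vanish when pushed to some stage above their support, rather
    than a span of generators; kernels in the limit can then be read off. *)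
Definition colim_sm : submod (dsum V).
Proof.
apply: (@Submod _ _ (fun x => exists j, below x j /\ push j x = 0)).
  by exists i0; split; [move=> i; rewrite linear0|exact: linear0].
move=> a x y [j [xj jx]] [k [yk ky]]; have [l [jl kl]] := le_directed j k.
exists l; split; last first.
  by rewrite linearP -(push_push xj jl) -(push_push yk kl) jx ky !linear0 scaler0 addr0.
move=> i; rewrite linearP => xyi; apply: contrapT => il; apply: xyi.
have -> : dpr i x = 0 by apply: contrapT => /(belowW xj jl).
have -> : dpr i y = 0 by apply: contrapT => /(belowW yk kl).
by rewrite scaler0 addr0.
Defined.

Lemma below_din i (v : V i) j : le i j -> below (din i v) j.
Proof.
move=> ij k kv; have [<-//|ik] := pselect (i = k).
by case: kv; rewrite dpr_din_off.
Qed.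

Lemma below_sub x y j : below x j -> below y j -> below (x - y) j.
Proof.
move=> xj yj i; rewrite linearB => xyi; apply: contrapT => ij; apply: xyi.
have -> : dpr i x = 0 by apply: contrapT => /xj.
have -> : dpr i y = 0 by apply: contrapT => /yj.
by rewrite subrr.
Qed.

Lemma colimit_exists : exists (L : lmodType R) (u : forall i, {linear V i -> L}),
  is_colimit u.
Proof.
exists (quotm colim_sm), (fun i => qpi colim_sm \o din i); split.
- move=> i j x ij; apply/eqP; rewrite /= -subr_eq0 -linearB; apply/eqP/qpi0.
  exists j; split; first by apply: below_sub; apply: below_din.
  by rewrite linearB /push !dlift_din f_id subrr.
- move=> z; have [x <-] := qpi_surj z; have [j xj] := below_exists x.
  exists j, (push j x); apply/eqP; rewrite /= -subr_eq0 -linearB; apply/eqP/qpi0.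
  exists j; split; first by apply: below_sub => //; apply: below_din.
  by rewrite linearB [push j (din _ _)]dlift_din f_id subrr.
(* If x = 0, its support is empty and says nothing about [j], so stage [i] itself is taken. *)
move=> i x /= /qpi0 [j [ij jx]]; have [->|x0] := pselect (x = 0).
  by exists i; rewrite linear0.
by exists j; split; [apply: ij; rewrite dpr_din|rewrite -jx /push dlift_din].
Qed.

Variables (L : lmodType R) (u : forall i, {linear V i -> L}).
Hypothesis colim : is_colimit u.

Lemma colimit_dlift x j : below x j -> dlift u x = u j (push j x).
Proof.
have [coh _ _] := colim.
by move=> xj; apply/esym/dlift_comp => i /xj ij; apply: coh.
Qed.

Lemma colimit_ker x : dlift u x = 0 -> exists j, below x j /\ push j x = 0.
Proof.
have [_ _ ker] := colim; have [j xj] := below_exists x.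
rewrite (colimit_dlift xj) => /ker [k [jk k0]]; exists k.
by split; [apply: belowW jk|rewrite -k0 (push_push xj jk)].
Qed.

Lemma colimit_univ (X : lmodType R) (g : forall i, {linear V i -> X}) :
  (forall i j x, le i j -> g j (f i j x) = g i x) ->
  exists h : {linear L -> X}, forall i x, h (u i x) = g i x.
Proof.
move=> coh; have [_ gen _] := colim.
have [||h hE] := @factor_epi _ _ _ _ (dlift u) (dlift g).
- by move=> z; have [i [x ->]] := gen z; exists (din i x); rewrite dlift_din.
- move=> x /colimit_ker [j [xj jx]]; rewrite -[LHS]/(dlift g x).
  rewrite -(@dlift_comp _ _ (g j) (fun i => f i j) g) => [|i /xj].
    by rewrite [dlift _ x]jx linear0.
  exact: coh.
by exists h => i x; rewrite -[u i x](dlift_din u) hE dlift_din.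
Qed.

(** Finitely many kernel elements vanish when pushed to a common stage [m]. The endomorphism sending
    v in V i to v minus its image in V m has values in the kernel and fixes them. *)
Lemma colimit_locally_split : locally_split_epi (dlift u).
Proof.
have [coh gen _] := colim; split.
  by move=> z; have [i [x ->]] := gen z; exists (din i x); rewrite dlift_din.
move=> k x x0; have [j jP] := choice (fun i => colimit_ker (x0 i)).
have [m jm] := upper_bound_seq [seq (j i : {classic I}) | i <- enum 'I_k].
have {}jm i : le (j i) m by apply: jm; apply/mapP; exists i; rewrite ?mem_enum.
(* Outside the indices below [m] the zero map keeps the values in the kernel. *)
pose g i : {linear V i -> dsum V} :=
  if pselect (le i m) is left _ then din i \- (din m \o f i m) else \0.
have gE i v : le i m -> g i v = din i v - din m (f i m v).
  by rewrite /g; case: pselect.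
exists (dlift g); split=> [b|i].
  apply: (@dsum_ext _ _ _ _ (dlift u \o dlift g) \0) => i v /=.
  rewrite dlift_din /g; case: pselect => [im|_] /=; last exact: linear0.
  by rewrite linearB !dlift_din coh// subrr.
have [xj x0'] := jP i; have xm := belowW xj (jm i).
have -> : dlift g (x i) = x i - din m (push m (x i)).
  rewrite (@dlift_congr _ g (fun i => din i \- (din m \o f i m))) => [|l /xm lm].
    apply: (@dsum_ext _ _ _ _ (dlift _) (idfun \- (din m \o push m))) => l v /=.
    by rewrite /push !dlift_din.
  exact: gE.
by rewrite -(push_push xj (jm i)) x0' !linear0 ?oppr0 addr0.
Qed.

End Colimit.

(** * Sequential direct limits *)

Section Sequence.
Variables (R : pzRingType) (V : nat -> lmodType R).
Variable d : forall i, {linear V i -> V i.+1}.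

Definition castlin i j (e : i = j) : {linear V i -> V j} :=
  ecast k {linear V i -> V k} e idfun.

(** Total in both indices: it is the zero map when j < i. *)
Fixpoint trans i j : {linear V i -> V j} :=
  if pselect (i = j) is left e then castlin e else
  match j with 0 => \0 | j'.+1 => d j' \o trans i j' end.

Lemma trans_id i x : trans i i x = x.
Proof.
by case: i x => [|i] x /=; case: pselect => // e; rewrite (eq_irrelevance e erefl).
Qed.

Lemma transS i j x : (i <= j)%N -> trans i j.+1 x = d j (trans i j x).
Proof. by move=> ij /=; case: pselect => // e; rewrite e ltnn in ij. Qed.

Lemma trans_comp i j k x : (i <= j)%N -> (j <= k)%N ->
  trans j k (trans i j x) = trans i k x.
Proof.
move=> ij; elim: k => [|k ih]; rewrite leq_eqVlt => /orP[/eqP jk|//].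
- by move: ij x; rewrite jk => ij x; rewrite trans_id.
- by move: ij x ih; rewrite jk => ij x _; rewrite trans_id.
by rewrite ltnS => jk; rewrite !transS ?ih// (leq_trans ij).
Qed.

Lemma trans_inj i j : (forall k, injective (d k)) -> (i <= j)%N -> injective (trans i j).
Proof.
move=> inj; elim: j => [|j ih].
  by rewrite leqn0 => /eqP -> x y; rewrite !trans_id.
rewrite leq_eqVlt => /orP[/eqP ->|]; first by move=> x y; rewrite !trans_id.
by rewrite ltnS => ij x y; rewrite !transS// => /inj /(ih ij).
Qed.

Variables (L : lmodType R) (u : forall i, {linear V i -> L}).
Hypothesis colim : is_colimit (fun i j => (i <= j)%N) trans u.

Lemma sequence_univ (X : lmodType R) (g : forall i, {linear V i -> X}) :
  (forall i x, g i.+1 (d i x) = g i x) ->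
  exists h : {linear L -> X}, forall i x, h (u i x) = g i x.
Proof.
move=> gd; pose le := fun i j : nat => (i <= j)%N : Prop.
have dir i j : exists k, le i k /\ le j k.
  by exists (maxn i j); rewrite /le leq_maxl leq_maxr.
have tran i j k : le i j -> le j k -> le i k by exact: leq_trans.
have comp i j k x : le i j -> le j k -> trans j k (trans i j x) = trans i k x.
  exact: trans_comp.
apply: (colimit_univ tran dir 0 comp colim).
move=> i j x; rewrite /le; elim: j => [|j ih].
  by rewrite leqn0 => /eqP i0; move: x; rewrite i0 => x; rewrite trans_id.
rewrite leq_eqVlt => /orP[/eqP ij|]; first by move: x ih; rewrite ij => x _; rewrite trans_id.
by rewrite ltnS => ij; rewrite transS// gd ih.
Qed.

(* Eklof's lemma for chains of length omega: a splitting is built stage by stage,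
   each step lifting against the epimorphism [p] with kernel [X]. *)
Lemma ext0_sequence X : (forall k, injective (d k)) ->
  (forall k, ext0 (quotm (im_sm (d k))) X) -> ext0 (quotm (im_sm (u 0))) X.
Proof.
move=> inj ext; have [coh gen ker] := colim; apply: ext0_split => E j p sp.
pose q := qpi (im_sm (u 0)).
(* The lifts of [q \o u k] along [p]. Since [q] kills the image of [u 0], the zero map starts the
   recursion, and the resulting map on [L] vanishes there. *)
pose W k := {w : {linear V k -> E} | forall x, p (w x) = q (u k x)}.
have W0P x : p ((\0 : {linear V 0 -> E}) x) = q (u 0 x).
  by rewrite linear0; apply/esym/qpi0; exists x.
pose W0 : W 0 := exist _ (\0 : {linear V 0 -> E}) W0P.
have uS k x : u k.+1 (d k x) = u k x.
  by rewrite -(coh k k.+1 x) ?leqnSn// transS// trans_id.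
have WS k (w : W k) : exists w' : W k.+1, forall x, sval w' (d k x) = sval w x.
  have sd : short_exact (d k) (qpi (im_sm (d k))).
    by split; [exact: inj|exact: coker_exact|exact: qpi_surj].
  have [|w' [w'd w'q]] :=
      @ext0_lifting _ _ _ _ _ _ _ _ _ j p (sval w) (q \o u k.+1) (ext k) sd sp.
    by move=> x /=; rewrite uS; exact: (svalP w).
  by exists (exist _ w' w'q).
pose w k : W k := nat_rect W W0 (fun k w => projT1 (cid (WS k w))) k.
have wd k x : sval (w k.+1) (d k x) = sval (w k) x.
  by rewrite /w /=; case: cid.
have [h hE] := sequence_univ (g := fun k => sval (w k)) wd.
apply: (@retract_of_section _ _ _ _ _ q j p h) => //.
- exact: qpi_surj.
- by move=> b; have [i [x ->]] := gen b; rewrite hE; exact: (svalP (w i)).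
- by move=> b /qpi0 [x <-]; rewrite hE.
Qed.

End Sequence.

(** * Special preenvelopes and precovers *)

Section SpecialApproximations.
Variables (R : pzRingType) (n : enat).
Hypothesis n1 : gt1 n.
Implicit Types M X Y : lmodType R.

Lemma FP_injP X : FP_inj n X <-> forall F : lmodType R, FP_class n F -> ext0 F X.
Proof. by split=> inj F /inj /Ext1P. Qed.

Lemma lperpP (K : lmodType R -> Prop) Y :
  lperp K Y <-> forall X, K X -> ext0 Y X.
Proof. by split=> perp X /perp /Ext1P. Qed.

Lemma FP_inj_locally_split (B C : lmodType R) (g : {linear B -> C}) :
  locally_split_epi g -> FP_inj n B -> FP_inj n C.
Proof.
move=> gs /FP_injP extB; apply/FP_injP => F FPF.
have [P] := FP_free_pres n1 FPF.
exact: (ext0_locally_split P gs (extB F FPF)).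
Qed.

Lemma FP_inj_dsum (I : Type) (V : I -> lmodType R) :
  (forall i, FP_inj n (V i)) -> FP_inj n (dsum V).
Proof.
move=> inj; apply/FP_injP => F FPF.
have [P] := FP_free_pres n1 FPF.
by apply: (ext0_dsum P) => i; have /FP_injP/(_ F FPF) := inj i.
Qed.

Definition FP_presents k m p (a : {linear 'rV[R]_m -> 'rV[R]_k})
    (b : {linear 'rV[R]_p -> 'rV[R]_m}) : Prop :=
  exact_at b a /\
  exists (F : lmodType R) (q : {linear 'rV[R]_k -> F}),
    [/\ FP_class n F, surjective q & exact_at a q].

(* Degree-1 cocycles of Hom(F, M), for F running over FP_n modules up to
   isomorphism; unlike the modules F, they form a type in the universe of M. *)
Record cocycle M := Cocycle {
  cc_k : nat; cc_m : nat; cc_p : nat;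
  cc_a : {linear 'rV[R]_cc_m -> 'rV[R]_cc_k};
  cc_b : {linear 'rV[R]_cc_p -> 'rV[R]_cc_m};
  cc_f : {linear 'rV[R]_cc_m -> M};
  cc_FP : FP_presents cc_a cc_b;
  cc_fb : forall z, cc_f (cc_b z) = 0 }.

(** One step of the small object argument: every cocycle of [M] becomes a coboundary in [Q]. *)
Record enlargement M (Q : lmodType R) (u : {linear M -> Q}) : Prop := Enlargement {
  enl_inj : injective u;
  enl_ext : forall t : cocycle M, exists g : {linear 'rV[R]_(cc_k t) -> Q},
    forall w, g (cc_a t w) = u (cc_f t w);
  enl_coker : forall X, FP_inj n X -> ext0 (quotm (im_sm u)) X }.

(** The pushout of the direct sum of all maps [cc_a] along the sum of all cocycles. *)
Lemma enlargement_exists M : exists (Q : lmodType R) (u : {linear M -> Q}), enlargement u.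
Proof.
pose a : {linear dsum (fun t : cocycle M => 'rV[R]_(cc_m t)) ->
    dsum (fun t : cocycle M => 'rV[R]_(cc_k t))} := dlift (fun t => din t \o cc_a t).
pose f := dlift (@cc_f M).
have a_pr t x : dpr t (a x) = cc_a t (dpr t x).
  apply: (@dsum_ext _ _ _ _ (dpr t \o a) (cc_a t \o dpr t)) => s v /=.
  rewrite dlift_din /=; have [<-|st] := pselect (s = t); first by rewrite !dpr_din.
  by rewrite !dpr_din_off// linear0.
have ker x : a x = 0 -> f x = 0.
  move=> ax; have [s [us xs]] := dsum_supp x.
  rewrite /f dliftE (dlift_funE _ us xs) big1// => t _.
  have [[bex _] fb] := (cc_FP t, @cc_fb _ t).
  have /bex [z <-] : cc_a t (dpr t x) = 0 by rewrite -a_pr ax linear0.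
  exact: fb.
have [Q [u [v [uinj va gen rel]]]] := pushout ker.
exists Q, u; split=> // [t|X injX].
  by exists (v \o din t) => w /=; rewrite -[cc_f t w](dlift_din (@cc_f M)) -va dlift_din.
(* The cokernel of [u] is presented by [a], so maps extend separately for each cocycle. *)
apply: (@ext0_pres _ _ _ _ _ a (qpi (im_sm u) \o v)).
- by apply: dsum_projective => t; exact: rv_projective.
- move=> y /=; split=> [/qpi0 [x uv]|[d <-]]; last first.
    by apply/qpi0; exists (f d); rewrite va.
  have [|d [_ ->]] := rel (- x) y; last by exists d.
  by rewrite linearN uv addNr.
- move=> c; have [q <-] := qpi_surj c; have [x [y ->]] := gen q.
  exists y; rewrite linearD [qpi _ (u x)](_ : _ = 0) ?add0r//.
  by apply/qpi0; exists x.
move=> h hker; have ext t : exists g : {linear 'rV[R]_(cc_k t) -> X},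
    forall w, g (cc_a t w) = h (din t w).
  have [_ [F [q [FPF qs aex]]]] := cc_FP t.
  have extX : ext0 F X by move/FP_injP: injX; apply.
  apply: (extX _ _ _ q aex qs (h \o din t)) => w aw /=; apply: hker.
  by rewrite dlift_din /= aw linear0.
exists (dlift (fun t => projT1 (cid (ext t)))).
apply: (@dsum_ext _ _ _ _ (dlift _ \o a) h) => t w /=.
by rewrite [a _]dlift_din /= dlift_din; case: cid.
Qed.

Definition enl_obj M : lmodType R := projT1 (cid (enlargement_exists M)).

Definition enl_map M : {linear M -> enl_obj M} :=
  projT1 (cid (projT2 (cid (enlargement_exists M)))).

Lemma enl_mapP M : enlargement (enl_map M).
Proof. exact: (projT2 (cid (projT2 (cid (enlargement_exists M))))). Qed.

Fixpoint tower M k : lmodType R :=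
  if k is k'.+1 then enl_obj (tower M k') else M.

Definition tower_map M k : {linear tower M k -> tower M k.+1} := enl_map (tower M k).

Definition special (M B : lmodType R) (phi : {linear M -> B}) : Prop :=
  [/\ injective phi, FP_inj n B & lperp (@FP_inj R n) (quotm (im_sm phi))].

(** The limit of an omega-tower of enlargements. A cocycle in the limit is finite data, so it
    descends to a finite stage and becomes a coboundary at the next; [ext0_sequence] treats the
    cokernel. *)
Lemma special_preenvelope M : exists (B : lmodType R) (phi : {linear M -> B}), special phi.
Proof.
pose le := fun i j : nat => (i <= j)%N : Prop.
have dir i j : exists k, le i k /\ le j k.
  by exists (maxn i j); rewrite /le leq_maxl leq_maxr.
have tran i j k : le i j -> le j k -> le i k by exact: leq_trans.
pose f := trans (tower_map M).
have f_id i x : f i i x = x by exact: trans_id.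
have f_comp i j k x : le i j -> le j k -> f j k (f i j x) = f i k x by exact: trans_comp.
have finj i j : le i j -> injective (f i j).
  by apply: trans_inj => k; apply: enl_inj (enl_mapP _).
have [L [u colim]] := @colimit_exists _ _ le leqnn tran dir 0 _ f f_id f_comp.
have [coh gen ker] := colim.
exists L, (u 0); split.
- move=> x y xy; have [|j [j0 xyj]] := ker 0 (x - y).
    by rewrite linearB xy subrr.
  apply/eqP; rewrite -subr_eq0; apply/eqP/(finj _ _ j0).
  by rewrite xyj linear0.
- apply/FP_injP => F FPF; have [P] := FP_free_pres n1 FPF.
  apply/(ext0_free_pres _ P) => g gb.
  have ub k (s : 'I_k -> nat) : exists j, forall i, le (s i) j.
    by exists (\max_i s i) => i; apply: leq_bigmax.
  have [s sP] := choice (fun l => gen (g (rdelta l))).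
  pose x l := projT1 (cid (sP l)); have [j sj] := ub _ s.
  have xP l : g (rdelta l) = u (s l) (x l) by rewrite /x; case: cid.
  pose g1 := rvlift (fun l => f (s l) j (x l)).
  have g1E w : u j (g1 w) = g w.
    apply: (@rv_ext _ _ _ (u j \o g1)) => l /=.
    by rewrite rvlift_delta coh// -xP.
  (* At stage [j] the relations hold only after passing to the limit; finitely many of them already
     hold at a later stage. *)
  have kerb z : exists k, le j k /\ f j k (g1 (fr_b P (rdelta z))) = 0.
    by apply: ker; rewrite g1E gb.
  have [t tP] := choice kerb.
  have [j' tj'] := ub _ t; have [k [jk j'k]] := dir j j'.
  have g1b z : (f j k \o g1) (fr_b P z) = 0.
    apply: (@rv_ext _ _ _ (f j k \o g1 \o fr_b P) \0) => l /=.
    have [jt t0] := tP l.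
    by rewrite -(f_comp _ _ _ _ jt (tran _ _ _ (tj' l) j'k)) t0 linear0.
  have FPP : FP_presents (fr_a P) (fr_b P).
    split; first exact: fr_ex1.
    by exists F, (fr_q P); split=> //; [exact: fr_surj|exact: fr_ex0].
  have [h hE] := enl_ext (enl_mapP (tower M k)) (Cocycle FPP g1b).
  have uk y : u k.+1 (tower_map M k y) = u k y.
    by rewrite -(coh k k.+1 y (leqnSn k)) /f transS// trans_id.
  exists (u k.+1 \o h) => w; rewrite -[LHS]/(u k.+1 (h (fr_a P w))) [h _]hE.
  by rewrite -[LHS]/(u k.+1 (tower_map M k (f j k (g1 w)))) uk coh// g1E.
apply/lperpP => X injX; apply: (ext0_sequence colim) => k.
  exact: enl_inj (enl_mapP _).
exact: enl_coker (enl_mapP _) _ injX.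
Qed.

(** Salce's argument: push out a free cover of [M] along a special preenvelope of its kernel. *)
Lemma special_precover M :
  exists (B L : lmodType R) (i : {linear B -> L}) (p : {linear L -> M}), [/\ short_exact i p, FP_inj n B & lperp (@FP_inj R n) L].
Proof.
pose P := free R M; pose q : {linear P -> M} := free_lift (@id M).
have qs : surjective q by move=> x; exists (delta _ x); rewrite free_lift_delta.
pose K := ker_sm q; have [B [phi [phinj injB perpC]]] := special_preenvelope (subm K).
have kphi (x : subm K) : sinc K x = 0 -> phi x = 0.
  by move=> x0; rewrite (_ : x = 0) ?linear0//; apply: (@sinc_inj _ _ K); rewrite x0 linear0.
have [Q [u [v [uinj vs gen rel]]]] := pushout kphi.
have suv : surjective (pairlin u v).
  by move=> y; have [b [x ->]] := gen y; exists (b, x).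
have [s|p pE] := @factor_epi _ _ _ _ (pairlin u v) (q \o snd) suv.
  by case: s => b x /= /rel [d [_ ->]]; exact: (@sincP _ _ K).
have [s|c cE] := @factor_epi _ _ _ _ (pairlin u v) (qpi (im_sm phi) \o fst) suv.
  by case: s => b x /= /rel [d [-> _]]; apply/qpi0; exists (- d); rewrite linearN.
have pu b : p (u b) = 0 by have := pE (b, 0); rewrite /= linear0 addr0 linear0.
have pv x : p (v x) = q x by have := pE (0, x); rewrite /= linear0 add0r.
have cu b : c (u b) = qpi _ b by have := cE (b, 0); rewrite /= linear0 addr0.
have cv x : c (v x) = 0 by have := cE (0, x); rewrite /= linear0 add0r linear0.
exists B, Q, u, p; split=> //.
  split=> // [y|x]; last by have [z <-] := qs x; exists (v z); rewrite pv.
  split=> [|[b <-]//]; have [b [x ->]] := gen y.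
  rewrite linearD pu pv add0r => /(@sinc_surj _ _ K) [d <-].
  by exists (b + phi d); rewrite linearD vs.
(* Read the other way, the pushout extends the cokernel of [phi] by the free module [P]. *)
have sv : short_exact v c.
  split=> [x y xy|y|z].
  - have [|d [d0 dx]] := rel 0 (x - y); first by rewrite linearB xy subrr linear0 addr0.
    apply/eqP; rewrite -subr_eq0 dx (_ : d = 0) ?linear0//.
    by apply: phinj; rewrite linear0 -[LHS]opprK -d0 oppr0.
  - split=> [|[x <-]//]; have [b [x ->]] := gen y.
    rewrite linearD cu cv addr0 => /qpi0 [d <-].
    by exists (sinc K d + x); rewrite linearD vs.
  - by have [b <-] := qpi_surj z; exists (u b).
apply/lperpP => X injX; apply: (ext0_extension sv); first exact: free_projective.
by move/lperpP: perpC => /(_ X injX).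
Qed.

End SpecialApproximations.

(** * Characters with values in Q/Z *)

Definition mkadd (A B : zmodType) (f : A -> B) (fB : zmod_morphism f) : {additive A -> B} :=
  HB.pack f (GRing.isZmodMorphism.Build A B f fB).

(** Euclidean division by the least positive element; d = 0 when there is none. *)
Lemma int_subgroup (S : int -> Prop) : S 0 -> (forall k l, S k -> S l -> S (k - l)) ->
  exists d : nat, forall k, S k <-> (d %| k)%Z.
Proof.
move=> S0 SB.
have SN k : S k -> S (- k) by move=> Sk; rewrite -sub0r; apply: SB.
have SD k l : S k -> S l -> S (k + l) by move=> Sk Sl; rewrite -[l]opprK; apply/SB/SN.
have SM k m : S k -> S (m * k).
  move=> Sk; elim: m => [|m ih|m ih]; first by rewrite mul0r.
    by rewrite -addn1 PoszD mulrDl mul1r; apply: SD.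
  by rewrite -addn1 PoszD opprD mulrDl mulN1r; apply: SB.
have [[d0 Sd0]|none] := pselect (exists d : nat, S d /\ (0 < d)%N); last first.
  exists 0 => k; split=> [Sk|]; last by rewrite dvd0z => /eqP ->.
  rewrite dvd0z; apply: contrapT => k0; apply: none; exists `|k|%N.
  split; last by rewrite absz_gt0; apply/negP.
  by case: (intP k) Sk => // m /SN; rewrite ?opprK.
have exd : exists d : nat, `[< S d /\ (0 < d)%N >] by exists d0; apply/asboolP.
case: (ex_minnP exd) => d /asboolP [Sd dgt0] dmin; exists d => k.
split=> [Sk|/dvdzP [m ->]]; last exact: SM.
have dn0 : (d : int) != 0 by rewrite eqz_nat -lt0n.
have Sr : S (k %% d)%Z.
  by rewrite /modz; apply/SB/SM.
rewrite dvdzE; apply: contrapT => /negP; rewrite -dvdzE => nd.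
have r0 : (k %% d)%Z != 0 by apply: contra nd => /eqP /dvdz_mod0P.
have := modz_ge0 k dn0; have := ltz_mod k dn0; move: r0 Sr.
case: (k %% d)%Z => // r r0 Sr rd _.
have : (d <= r)%N by apply: dmin; apply/asboolP; split=> //; rewrite lt0n.
by move: rd; rewrite ger0_norm// ltz_nat ltnNge => /negP.
Qed.

Section RationalCircle.

Local Notation QZq :=
  (Quotient.quot (GRing.ZmodClosed.clone rat (@Num.int_num_subdef rat) _)).

Definition qz (x : rat) : QZ := \pi_QZq x.

Lemma qz_eq0 x : qz x = 0 <-> x \is a Num.int.
Proof.
have -> : (0 : QZ) = qz 0 by exact: (esym (raddf0 (\pi_QZq))).
split=> [/eqP|xi]; first by rewrite -Quotient.idealrBE subr0.
by apply/eqP; rewrite -Quotient.idealrBE subr0.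
Qed.

Lemma qzB : zmod_morphism qz.
Proof. exact: (pi_is_zmod_morphism QZq). Qed.

Lemma qzMz x k : qz x *~ k = qz (x *~ k).
Proof. by rewrite -[qz x]/(mkadd qzB x) -raddfMz. Qed.

Lemma qz_surj : surjective qz.
Proof. by move=> y; exists (repr (y : QZq)); rewrite /qz reprK. Qed.

Lemma QZ_divisible (y : QZ) (d : nat) : (0 < d)%N -> exists z, z *~ d = y.
Proof.
move=> d0; have [x <-] := qz_surj y; exists (qz (x / d%:R)).
rewrite qzMz; congr qz; rewrite -mulrzl [_%:~R](_ : _ = d%:R)//.
by rewrite mulrC divfK// pnatr_eq0 -lt0n.
Qed.

(** The class of 1/d, or of 1/2 when d = 0 and the equation is void. *)
Lemma qz_torsion (d : nat) : d != 1 -> exists c : QZ, c != 0 /\ c *~ d = 0.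
Proof.
case: d => [_|[//|d _]].
  exists (qz 2^-1); split=> //; apply/eqP => /qz_eq0 /intrP [m mE].
  have : (2 * m)%:~R = 1%:~R :> rat by rewrite rmorphM /= -mE mulfV.
  by move/eqP; rewrite eqr_int => /eqP /(congr1 absz) /eqP; rewrite abszM muln_eq1.
exists (qz d.+2%:R^-1); split; last first.
  rewrite qzMz -mulrzl [_%:~R](_ : _ = d.+2%:R)// mulfV ?pnatr_eq0//.
  by apply/qz_eq0.
apply/eqP => /qz_eq0 /intrP [m mE].
have : (d.+2%:Z * m)%:~R = 1%:~R :> rat by rewrite rmorphM /= -mE mulfV// pnatr_eq0.
by move/eqP; rewrite eqr_int => /eqP /(congr1 absz) /eqP; rewrite abszM muln_eq1.
Qed.

End RationalCircle.

(** * Injectivity of Q/Z *)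

Section Injectivity.
Variables (A B : zmodType) (u : {additive A -> B}) (f : {additive A -> QZ}).
Hypothesis ker : forall a, u a = 0 -> f a = 0.

(* The graph of a character of a subgroup of B containing the image of u. *)
Record partial_char := PartialChar {
  pc_graph :> B -> QZ -> Prop;
  pc_base : forall a, pc_graph (u a) (f a);
  pc_sub : forall b c y z, pc_graph b y -> pc_graph c z -> pc_graph (b - c) (y - z);
  pc_fun : forall y, pc_graph 0 y -> y = 0 }.

Lemma base_char : partial_char.
Proof.
refine (@PartialChar (fun b y => exists a, b = u a /\ y = f a) _ _ _).
- by move=> a; exists a.
- by move=> _ _ _ _ [a [-> ->]] [a' [-> ->]]; exists (a - a'); rewrite !raddfB.
- by move=> y [a [/esym/ker <- ->]].
Qed.

Lemma pc_mulz (G : partial_char) b y k : G b y -> G (b *~ k) (y *~ k).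
Proof.
move=> Gby; have G0 : G 0 0 by rewrite -(subrr b) -(subrr y); apply: pc_sub.
have GN : G (- b) (- y) by rewrite -[- b]sub0r -[- y]sub0r; apply: pc_sub.
elim: k => [|k ih|k ih]; first by rewrite !mulr0z.
  rewrite -addn1 PoszD !mulrzDr !mulr1z.
  by have := pc_sub ih GN; rewrite !opprK.
by rewrite -addn1 PoszD opprD !mulrzDr !mulrN1z; apply: pc_sub.
Qed.

Lemma pc_eq (G : partial_char) b y z : G b y -> G b z -> y = z.
Proof.
move=> Gy Gz; apply/eqP; rewrite -subr_eq0; apply/eqP/(pc_fun (p := G)).
by rewrite -(subrr b); apply: pc_sub.
Qed.

(** The multiples of [b] in the domain are those by multiples of some [d]. The value at d b is
    divided by [d], using divisibility of Q/Z; for d = 0 the value 0 is chosen. *)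
Lemma pc_enlarge (G : partial_char) b : exists (G' : partial_char),
  (forall c y, G c y -> G' c y) /\ exists y, G' b y.
Proof.
have G0 : G 0 0 by have := pc_base G 0; rewrite !raddf0.
have [d dP] : exists d : nat, forall k, (exists y, G (b *~ k) y) <-> (d %| k)%Z.
  apply: int_subgroup => [|k l [y ky] [z lz]]; first by exists 0; rewrite mulr0z.
  by exists (y - z); rewrite mulrzBr; apply: pc_sub.
have [z0 Gz0] : exists y, G (b *~ d) y by apply/dP.
have [y yd] : exists y, y *~ d = z0.
  case: d dP Gz0 => [_|d _ _]; last exact: QZ_divisible.
  by rewrite mulr0z => /pc_fun ->; exists 0; rewrite mulr0z.
pose H c z := exists k c' z', [/\ G c' z', c = c' + b *~ k & z = z' + y *~ k].
have Hbase a : H (u a) (f a).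
  by exists 0, (u a), (f a); rewrite !mulr0z !addr0; split=> //; exact: pc_base.
have Hsub b1 c1 y1 z1 : H b1 y1 -> H c1 z1 -> H (b1 - c1) (y1 - z1).
  move=> [k [c [z [Gcz -> ->]]]] [l [c' [z' [Gcz' -> ->]]]].
  exists (k - l), (c - c'), (z - z'); split; first exact: pc_sub.
    by rewrite opprD addrACA mulrzBr.
  by rewrite opprD addrACA mulrzBr.
have Hfun z : H 0 z -> z = 0.
  move=> [k [c [z' [Gcz /esym/eqP]]]]; rewrite addr_eq0 => /eqP ck ->.
  have /dvdzP [m mk] : (d %| k)%Z.
    apply/dP; exists (- z'); rewrite -[b *~ k]opprK -ck -sub0r -[- z']sub0r.
    exact: pc_sub.
  have Gk : G (b *~ k) (y *~ k).
    by rewrite mk mulrC !mulrzA yd; apply: pc_mulz.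
  have Gk' : G (- (b *~ k)) (- (y *~ k)).
    by rewrite -[- (b *~ k)]sub0r -[- (y *~ k)]sub0r; apply: pc_sub.
  by rewrite ck in Gcz; rewrite (pc_eq Gcz Gk') addNr.
exists (PartialChar Hbase Hsub Hfun); split=> [c z Gcz|].
  by exists 0, c, z; rewrite !mulr0z !addr0.
by exists y, 1, 0, 0; rewrite !add0r !mulr1z.
Qed.

(** Zorn's lemma for partial characters; by [pc_enlarge] a maximal one is total. *)
Lemma QZ_extend : exists g : {additive B -> QZ}, forall a, g (u a) = f a.
Proof.
pose le (G H : partial_char) := `[< forall b y, G b y -> H b y >].
have [G Gmax] : exists G, classical_sets.premaximal le G.
  apply: (classical_sets.ZL_preorder base_char) => [G|G H K|C tot].
  - exact/asboolP.
  - by move=> /asboolP GH /asboolP HK; apply/asboolP => b y /GH /HK.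
  (* The empty chain is bounded by [base_char]. *)
  have [[G0 CG0]|empty] := pselect (exists G, C G); last first.
    by exists base_char => G CG; case: empty; exists G.
  pose U b y := exists G : partial_char, C G /\ G b y.
  have Ubase a : U (u a) (f a) by exists G0; split=> //; exact: pc_base.
  have Usub b c y z : U b y -> U c z -> U (b - c) (y - z).
    move=> [G [CG Gby]] [H [CH Hcz]].
    have [/asboolP GH|/asboolP HG] := tot G H CG CH.
      by exists H; split=> //; apply: pc_sub => //; apply: GH.
    by exists G; split=> //; apply: pc_sub => //; apply: HG.
  have Ufun y : U 0 y -> y = 0 by move=> [G [_ /pc_fun]].
  exists (PartialChar Ubase Usub Ufun) => G CG; apply/asboolP => b y Gby.
  by exists G.
have dom b : exists y, G b y.
  have [H [GH [y Hby]]] := pc_enlarge G b; exists y.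
  by have /asboolP := Gmax H (introT (asboolP _) GH); apply.
have [g gP] := choice dom.
have gB : zmod_morphism g.
  by move=> b c; apply: (pc_eq (gP _)); apply: pc_sub.
exists (mkadd gB) => a /=.
exact: (pc_eq (gP _) (pc_base G a)).
Qed.

End Injectivity.

(** If [t] has order [d] modulo the image of [u] (d = 0 if infinite), a nonzero [c] killed by [d]
    gives a character u a + k t |-> k c of a subgroup, which extends to [G]. *)
Lemma QZ_separate (A G : zmodType) (u : {additive A -> G}) (t : G) :
  ~ (exists a, u a = t) ->
  exists chi : {additive G -> QZ}, (forall a, chi (u a) = 0) /\ chi t != 0.
Proof.
move=> tu.
have [d dP] : exists d : nat, forall k, (exists a, u a = t *~ k) <-> (d %| k)%Z.
  apply: int_subgroup => [|k l [a ak] [b bl]].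
    by exists 0; rewrite mulr0z raddf0.
  by exists (a - b); rewrite raddfB ak bl mulrzBr.
have [|c [c0 cd]] := @qz_torsion d.
  by apply/eqP => d1; apply: tu; apply/(dP 1); rewrite d1.
have vB : zmod_morphism (fun s : (A * int)%type => u s.1 + t *~ s.2).
  by move=> s s' /=; rewrite raddfB mulrzBr opprD addrACA.
have fB : zmod_morphism (fun s : (A * int)%type => c *~ s.2).
  by move=> s s' /=; rewrite mulrzBr.
have [[a k] /= /eqP|chi chiE] := @QZ_extend _ _ (mkadd vB) (mkadd fB).
  rewrite addr_eq0 => /eqP uk; have /dvdzP [m ->] : (d %| k)%Z.
    by apply/dP; exists (- a); rewrite raddfN uk opprK.
  by rewrite mulrC mulrzA cd mul0rz.
exists chi; split=> [a|].
  by have := chiE (a, 0); rewrite /= !mulr0z addr0.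
by have := chiE (0, 1); rewrite /= raddf0 add0r !mulr1z => ->.
Qed.

(** * Character modules on both sides *)

Section Duals.
Variable R : pzRingType.

Definition mkdual (M : lmodType R) (f : {additive M -> QZ}) : dual M :=
  Dual (introT (asboolP (zmod_morphism f)) (raddfB f)).

Lemma mkdualE (M : lmodType R) (f : {additive M -> QZ}) x : mkdual f x = f x.
Proof. by []. Qed.

Lemma dual_eqP (M : lmodType R) (f g : dual M) : (forall x, f x = g x) -> f = g.
Proof. by move=> fg; apply/val_inj/funext. Qed.

Lemma dualB (M : lmodType R) (f g : dual M) x : dual_val (f - g) x = f x - g x.
Proof. by []. Qed.

Lemma dualD (M : lmodType R) (f g : dual M) x : dual_val (f + g) x = f x + g x.
Proof. by []. Qed.

Lemma dualZ (M : lmodType R) (r : R) (f : dual M) x :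
  dual_val ((r : R^c) *: f) x = f (r *: x).
Proof. by []. Qed.

Definition eval_dual (M : lmodType R) (x : M) : {additive dual M -> QZ} :=
  mkadd (fun f g => dualB f g x).

Section DualMap.
Variables (A B : lmodType R) (f : {linear A -> B}).

Lemma dual_map_linear : linear (fun phi : dual B => mkdual (phi \o f)).
Proof.
move=> r phi psi; apply: dual_eqP => x; rewrite [RHS]dualD dualZ !mkdualE.
by rewrite -[LHS]/(dual_val (r *: phi + psi) (f x)) dualD dualZ /= linearZ.
Qed.

Definition dual_map : {linear dual B -> dual A} := locked (mklin dual_map_linear).

Lemma dual_mapE phi x : dual_map phi x = phi (f x).
Proof. by rewrite /dual_map -lock. Qed.

End DualMap.

(* The left module N^+ of a right module N. As an abelian group it is [dual N];
   only the scalar ring is changed, from (R^c)^c to R. *)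
Definition rdual (N : lmodType R^c) : Type := dual N.

HB.instance Definition _ (N : lmodType R^c) := GRing.Zmodule.on (rdual N).

Section RightDual.
Variable N : lmodType R^c.

Definition rdual_scale (r : R) (f : rdual N) : rdual N :=
  @dual_scale R^c N (r : R^c^c) f.

Lemma rdual_scaleA a b f : rdual_scale a (rdual_scale b f) = rdual_scale (a * b) f.
Proof. exact: dual_scaleA. Qed.

Lemma rdual_scale1 : left_id 1 rdual_scale. Proof. exact: dual_scale1. Qed.

Lemma rdual_scaleDr : right_distributive rdual_scale +%R.
Proof. by move=> a f g; apply: (@dual_scaleDr R^c N a f g). Qed.

Lemma rdual_scaleDl f : {morph rdual_scale^~ f : a b / a + b}.
Proof. by move=> a b; apply: (@dual_scaleDl R^c N f a b). Qed.

HB.instance Definition _ := GRing.Zmodule_isLmodule.Build R (rdual N)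
  rdual_scaleA rdual_scale1 rdual_scaleDr rdual_scaleDl.

Definition rval (f : rdual N) : {additive N -> QZ} := (f : dual N).

Definition mkrdual (f : {additive N -> QZ}) : rdual N :=
  Dual (introT (asboolP (zmod_morphism f)) (raddfB f)).

Lemma mkrdualE (f : {additive N -> QZ}) x : rval (mkrdual f) x = f x.
Proof. by []. Qed.

Lemma rdual_eqP (f g : rdual N) : (forall x, rval f x = rval g x) -> f = g.
Proof. by move=> fg; apply/val_inj/funext. Qed.

Lemma rdualD (f g : rdual N) x : rval (f + g) x = rval f x + rval g x.
Proof. by []. Qed.

Lemma rdualB (f g : rdual N) x : rval (f - g) x = rval f x - rval g x.
Proof. by []. Qed.

Lemma rdualZ (r : R) (f : rdual N) x : rval (r *: f) x = rval f ((r : R^c) *: x).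
Proof. by []. Qed.

Lemma rdual0 x : rval 0 x = 0. Proof. by []. Qed.

End RightDual.

Section RightDualMap.
Variables (M N : lmodType R^c) (f : {linear M -> N}).

Lemma rdual_map_linear : linear (fun phi : rdual N => mkrdual (rval phi \o f)).
Proof.
move=> r phi psi; apply: rdual_eqP => x.
rewrite [RHS]rdualD rdualZ !mkrdualE.
by rewrite -[LHS]/(rval (r *: phi + psi) (f x)) rdualD rdualZ /= linearZ.
Qed.

Definition rdual_map : {linear rdual N -> rdual M} := locked (mklin rdual_map_linear).

Lemma rdual_mapE phi x : rval (rdual_map phi) x = rval phi (f x).
Proof. by rewrite /rdual_map -lock. Qed.

End RightDualMap.

(* Both are the group of balanced pairings N x M -> Q/Z. *)
Lemma pairing_left (M : lmodType R) (N : lmodType R^c) (f : {linear N -> dual M}) :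
  exists g : {linear M -> rdual N}, forall n x, rval (g x) n = f n x.
Proof.
have gB x : zmod_morphism (fun n => f n x) by move=> n m; rewrite linearB.
have gl : linear (fun x => mkrdual (mkadd (gB x))).
  move=> r x y; apply: rdual_eqP => n; rewrite rdualD rdualZ !mkrdualE /=.
  by rewrite linearZ raddfD dualZ.
by exists (mklin gl).
Qed.

Lemma pairing_right (M : lmodType R) (N : lmodType R^c) (g : {linear M -> rdual N}) :
  exists f : {linear N -> dual M}, forall n x, rval (g x) n = f n x.
Proof.
have fB n : zmod_morphism (fun x => rval (g x) n) by move=> x y; rewrite linearB.
have fl : linear (fun n => mkdual (mkadd (fB n))).
  move=> r n m; apply: dual_eqP => x; rewrite dualD dualZ !mkdualE /=.
  by rewrite linearZ raddfD rdualZ.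
by exists (mklin fl).
Qed.

End Duals.

(** * Characters of tensor products *)

Section TensorCharacters.
Variables (R : pzRingType) (N : lmodType R^c).
Implicit Types M : lmodType R.

Lemma tens_additive M (x : M) : zmod_morphism (fun n : N => tens n x).
Proof. by move=> n m; apply/eqP; rewrite eq_sym subr_eq -tensDl subrK. Qed.

Lemma tens0 M (n : N) : tens n (0 : M) = 0.
Proof. by apply: (@addrI _ (tens n 0)); rewrite -tensDr !addr0. Qed.

Lemma tensor_decomp M (t : tensor N M) :
  exists s : seq (N * M), t = \sum_(e <- s) tens e.1 e.2.
Proof.
elim/quotW: t => D.
pose pi_ : {additive {freeg (N * M)%type / int} -> tensor N M} :=
  mkadd (@pi_tensorB R N M).
rewrite -[\pi D]/(pi_ D) -(Freeg_enum D).
elim: (fgenum D) => [|[k [n x]] s [r rE]].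
  by exists [::]; rewrite big_nil freeg_nil raddf0.
(* The integer coefficient is absorbed into the left factor. *)
exists ((n *~ k, x) :: r); rewrite -cat1s freeg_cat raddfD rE big_cons; congr (_ + _).
have -> : [freeg [:: (k, (n, x))]] = tgen n x *~ k.
  by rewrite /tgen freeg_mulz intz.
by rewrite raddfMz -[LHS]/(mkadd (tens_additive x) n *~ k) -raddfMz.
Qed.

Lemma tensor_ext M (G : zmodType) (f g : {additive tensor N M -> G}) :
  (forall n x, f (tens n x) = g (tens n x)) -> forall t, f t = g t.
Proof.
by move=> fg t; have [s ->] := tensor_decomp t; rewrite !raddf_sum; apply: eq_bigr.
Qed.

(** Together with [char_tensor], this is the adjunction between Hom(N (x) M, Q/Z) and Hom(N,
    M^+). *)
Lemma tensor_char M (f : {linear N -> dual M}) :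
  exists chi : {additive tensor N M -> QZ}, forall n x, chi (tens n x) = f n x.
Proof.
(* [zmodule QZ] is Q/Z as a module over the integers, the form of target that lifting from the free
   abelian group uses. *)
pose b (p : N * M) : zmodule QZ := f p.1 p.2.
pose h : {additive {freeg (N * M)%type / int} -> zmodule QZ} := mkadd (lift_is_additive b).
have hg n x : h (tgen n x) = f n x.
  by rewrite /h /= /tgen liftU scale1r.
have h0 t : tensor_null t -> h t = 0.
  elim=> {t} [n n' x|n x x'|n r x||t u _ ht _ hu].
  - by rewrite raddfB raddfD !hg linearD dualD subrr.
  - by rewrite raddfB raddfD !hg raddfD subrr.
  - by rewrite raddfB !hg linearZ dualZ subrr.
  - exact: raddf0.
  - by rewrite raddfB ht hu subr0.
have hpi t u : \pi_(tensor N M) t = \pi_(tensor N M) u -> h t = h u.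
  by move=> /tensor_eqP /h0 /eqP; rewrite raddfB subr_eq0 => /eqP.
have chiB : zmod_morphism (fun t : tensor N M => h (repr t) : QZ).
  by move=> t u; rewrite -[RHS]raddfB; apply: hpi; rewrite pi_tensorB !reprK.
exists (mkadd chiB) => n x /=; rewrite -hg; apply: hpi.
by rewrite reprK.
Qed.

Lemma char_tensor M (chi : {additive tensor N M -> QZ}) :
  exists f : {linear N -> dual M}, forall n x, chi (tens n x) = f n x.
Proof.
have fB n : zmod_morphism (fun x : M => chi (tens n x)).
  move=> x y; rewrite -raddfB; congr (chi _).
  by apply/eqP; rewrite eq_sym subr_eq -tensDr subrK.
have fl : linear (fun n => mkdual (mkadd (fB n))).
  move=> r n m; apply: dual_eqP => x; rewrite dualD dualZ !mkdualE /=.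
  by rewrite tensDl raddfD tensZ.
by exists (mklin fl).
Qed.

Definition tmap (M M' : lmodType R) (f : {linear M -> M'}) :
    {additive tensor N M -> tensor N M'} :=
  mkadd (tensor_map_zmod_morphism (N := N) f).

Lemma tmapE M M' (f : {linear M -> M'}) t : tmap f t = tensor_map f t.
Proof. by []. Qed.

Lemma tmap_tens M M' (f : {linear M -> M'}) n x : tmap f (tens n x) = tens n (f x).
Proof. exact: tensor_map_tens. Qed.

(* Right exactness is tested against characters of N (x) B, that is against
   homomorphisms N -> dual B. *)
Lemma tensor_right_exact (A B C : lmodType R) (f : {linear A -> B}) (g : {linear B -> C}) :
  exact_at f g -> surjective g ->
  exact_at (tensor_map (N := N) f) (tensor_map (N := N) g) /\
  surjective (tensor_map (N := N) g).
Proof.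
move=> ex gs; split=> t; last first.
  apply: contrapT => nt.
  have [|chi [chi0 /eqP]] := @QZ_separate _ _ (tmap g) t.
    by move=> [s st]; apply: nt; exists s.
  apply; apply: (@tensor_ext _ _ chi \0) => n c.
  by have [b <-] := gs c; rewrite -tmap_tens chi0.
split=> [gt|[s <-]]; last first.
  apply: (@tensor_ext _ _ (tmap g \o tmap f) \0) => n a.
  have gf : g (f a) = 0 by apply/ex; exists a.
  by rewrite -[LHS]/(tmap g (tmap f (tens n a))) !tmap_tens gf tens0.
apply: contrapT => nt.
have [|chi [chi0 /eqP]] := @QZ_separate _ _ (tmap f) t.
  by move=> [s st]; apply: nt; exists s.
apply; have [h hE] := char_tensor chi.
have hker n b : g b = 0 -> h n b = 0.
  by move=> /ex [a <-]; rewrite -hE -tmap_tens chi0.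
(* Each [h n] vanishes on ker g, so [h] takes values in the image of C^+ and factors through it. *)
have [|n|h' h'E] := @factor_mono _ _ _ _ (dual_map g) h.
- move=> phi psi pp; apply: dual_eqP => c; have [b <-] := gs c.
  by rewrite -!dual_mapE pp.
- have [phi phiE] : exists phi : C -> QZ, forall b, phi (g b) = h n b.
    have [s sE] := choice gs; exists (fun c => h n (s c)) => b.
    apply/eqP; rewrite -subr_eq0 -raddfB; apply/eqP/hker.
    by rewrite linearB sE subrr.
  have phiB : zmod_morphism phi.
    move=> c c'; have [b <-] := gs c; have [b' <-] := gs c'.
    by rewrite -linearB !phiE raddfB.
  by exists (mkdual (mkadd phiB)); apply: dual_eqP => b; rewrite dual_mapE -phiE.
have [chi' chi'E] := tensor_char h'.
transitivity (chi' (tmap g t)); last by rewrite tmapE gt raddf0.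
apply: (@tensor_ext _ _ chi (chi' \o tmap g)) => n b.
by rewrite -[RHS]/(chi' (tmap g (tens n b))) tmap_tens chi'E hE -h'E dual_mapE.
Qed.

End TensorCharacters.

(** * Tor, purity and duality *)

Section TorExt.
Variables (R : pzRingType) (N : lmodType R^c).
Implicit Types M : lmodType R.

Lemma char_pairing M (chi : {additive tensor N M -> QZ}) :
  exists g : {linear M -> rdual N}, forall n x, rval (g x) n = chi (tens n x).
Proof.
have [f fE] := char_tensor chi; have [g gE] := pairing_left f.
by exists g => n x; rewrite gE fE.
Qed.

Lemma pairing_char M (g : {linear M -> rdual N}) :
  exists chi : {additive tensor N M -> QZ}, forall n x, rval (g x) n = chi (tens n x).
Proof.
have [f fE] := pairing_right g; have [chi chiE] := tensor_char f.
by exists chi => n x; rewrite fE chiE.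
Qed.

(** Hom(P, N^+) is the character group of N (x) P. Extending characters turns exactness of the
    tensor complex into exactness of the Hom complex; separating by characters gives the
    converse. *)
Lemma Tor1P (F : lmodType R) : Tor1_zero N F <-> Ext1_zero F (rdual N).
Proof.
split=> [tor P f fd|ext P].
  have [chi chiE] := pairing_char f.
  have ker t : tmap N (res_d P 0) t = 0 -> chi t = 0.
    move=> /(tor P) [s <-].
    apply: (@tensor_ext _ _ _ _ (chi \o tmap N (res_d P 1)) \0) => n x.
    rewrite -[LHS]/(chi (tmap N (res_d P 1) (tens n x))) tmap_tens -chiE fd.
    exact: rdual0.
  have [chi' chi'E] := QZ_extend ker.
  have [g gE] := char_pairing chi'.
  exists g => z; apply: rdual_eqP => n.
  by rewrite chiE gE -tmap_tens chi'E.
have dd z : res_d P 0 (res_d P 1 z) = 0 by apply/(@res_exact _ _ P 0); exists z.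
move=> t; split=> [td|[s <-]]; last first.
  apply: (@tensor_ext _ _ _ _ (tmap N (res_d P 0) \o tmap N (res_d P 1)) \0) => n x.
  rewrite -[LHS]/(tmap N (res_d P 0) (tmap N (res_d P 1) (tens n x))).
  by rewrite !tmap_tens dd tens0.
apply: contrapT => nt.
have [|chi [chi0 /eqP]] := @QZ_separate _ _ (tmap N (res_d P 1)) t.
  by move=> [s st]; apply: nt; exists s.
apply; have [f fE] := char_pairing chi.
have [z|g gE] := ext P f.
  by apply: rdual_eqP => n; rewrite fE -tmap_tens chi0.
have [chi' chi'E] := pairing_char g.
transitivity (chi' (tmap N (res_d P 0) t)); last by rewrite tmapE td raddf0.
apply: (@tensor_ext _ _ _ _ chi (chi' \o tmap N (res_d P 0))) => n x.
rewrite -[RHS]/(chi' (tmap N (res_d P 0) (tens n x))) tmap_tens.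
by rewrite -fE gE chi'E.
Qed.

End TorExt.

Lemma FP_flatP (R : pzRingType) (n : enat) (N : lmodType R^c) :
  FP_flat n N <-> FP_inj n (rdual N).
Proof. by split=> h F /h /Tor1P. Qed.

Section Tuples.
Variables (G : zmodType) (k : nat).

Definition tin (i : 'I_k) (v : G) : 'I_k -> G := fun j => v *+ (j == i).

Lemma tin_additive i : zmod_morphism (tin i).
Proof. by move=> v w; apply/funext => j; rewrite /tin mulrnBl. Qed.

Lemma tuple_sum (z : 'I_k -> G) : z = \sum_i tin i (z i).
Proof.
apply/funext => j; rewrite fct_sumE (bigD1 j)//= big1 => [|i ij].
  by rewrite /tin eqxx addr0.
by rewrite /tin eq_sym (negbTE ij).
Qed.

Lemma tuple_sum_tin (H : zmodType) (h : 'I_k -> {additive G -> H}) i v :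
  \sum_j h j (tin i v j) = h i v.
Proof.
rewrite (bigD1 i)//= big1 => [|j ji]; first by rewrite /tin eqxx addr0.
by rewrite /tin (negbTE ji) raddf0.
Qed.

End Tuples.

(** * Double duals and finite linear systems *)

Section DoubleDual.
Variables (R : pzRingType) (F K : lmodType R) (P : free_pres F).
Hypothesis extK : ext0 F K.

Let alpha l i : R := fr_a P (rdelta l) 0 i.
Let beta q l : R := fr_b P (rdelta q) 0 l.

Lemma rv_linear_sum k (X : lmodType R) (h : {linear 'rV[R]_k -> X}) u :
  h u = \sum_i u 0 i *: h (rdelta i).
Proof.
by rewrite {1}(row_sum_delta u) linear_sum; apply: eq_bigr => i _; rewrite linearZ.
Qed.

(** [acol] and [bcol] are Hom(fr_a, K) and Hom(fr_b, K) in coordinates; [acolP] is Ext^1(F, K) =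
    0. *)
Let acol (y : 'I_(fr_k P) -> K) : 'I_(fr_m P) -> K := fun l => \sum_i alpha l i *: y i.
Let bcol (x : 'I_(fr_m P) -> K) : 'I_(fr_p P) -> K := fun q => \sum_l beta q l *: x l.

Let acolP x : bcol x = 0 -> exists y, acol y = x.
Proof.
move=> bx; have [z|g gE] := (ext0_free_pres K P).1 extK (rvlift x).
  apply: (@rv_ext _ _ _ (rvlift x \o fr_b P) \0) => q /=.
  by rewrite rvliftE; have := congr1 (fun f => f q) bx.
exists (fun i => g (rdelta i)); apply/funext => l.
by rewrite /acol -rv_linear_sum gE rvlift_delta.
Qed.

Let bcolB : zmod_morphism bcol.
Proof.
move=> x y; apply/funext => q; rewrite /bcol -[RHS]sumrB.
by apply: eq_bigr => l _; rewrite scalerBr.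
Qed.

(** The dual of [acol], with characters of K^m identified with m-tuples in K^+. *)
Let arow (phi : 'I_(fr_m P) -> dual K) : 'I_(fr_k P) -> dual K :=
  fun i => \sum_l (alpha l i : R^c) *: phi l.

Let arowB : zmod_morphism arow.
Proof.
move=> x y; apply/funext => q; rewrite /arow -[RHS]sumrB.
by apply: eq_bigr => l _; rewrite scalerBr.
Qed.

Variable f : {linear 'rV[R]_(fr_m P) -> rdual (dual K)}.
Hypothesis fb : forall z, f (fr_b P z) = 0.

Let xi l : rdual (dual K) := f (rdelta l).
(** The cocycle [f], seen as a character of (K^+)^m. *)
Let Xi (phi : 'I_(fr_m P) -> dual K) : QZ := \sum_l rval (xi l) (phi l).

Let XiB : zmod_morphism Xi.
Proof.
by move=> x y; rewrite /Xi -sumrB; apply: eq_bigr => l _; rewrite raddfB.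
Qed.

Lemma dual_sum (M : lmodType R) (I : Type) (r : seq I) (h : I -> dual M) x :
  dual_val (\sum_(i <- r) h i) x = \sum_(i <- r) dual_val (h i) x.
Proof. exact: (raddf_sum (eval_dual x)). Qed.

(** Such a [phi] is a character of K^m that kills the image of [acol], hence the kernel of [bcol],
    so it factors through [bcol]. This writes [phi] as a combination of the relations, on which [Xi]
    vanishes because f b = 0. *)
Let Xi_ker phi : arow phi = 0 -> Xi phi = 0.
Proof.
move=> aphi.
have chiB : zmod_morphism (fun x : 'I_(fr_m P) -> K => \sum_l phi l (x l)).
  by move=> x y; rewrite -sumrB; apply: eq_bigr => l _; rewrite -raddfB.
have [x /acolP [y <-] /=|psi psiE] := @QZ_extend _ _ (mkadd bcolB) (mkadd chiB).
  under eq_bigr do rewrite /acol raddf_sum.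
  rewrite exchange_big big1//= => i _.
  transitivity (dual_val (arow phi i) (y i)); last by rewrite aphi.
  by rewrite /arow dual_sum.
have phiE l : phi l =
    \sum_q (beta q l : R^c) *: mkdual (psi \o mkadd (@tin_additive K (fr_p P) q)).
  apply: dual_eqP => v; rewrite dual_sum.
  have := psiE (tin l v).
  rewrite /= (tuple_sum_tin (fun l => phi l : {additive K -> QZ})) => <-.
  rewrite (tuple_sum (bcol _)) raddf_sum; apply: eq_bigr => q _.
  congr (psi (tin q _)); rewrite /bcol.
  rewrite (bigD1 l)//= big1 => [|j jl]; first by rewrite /tin eqxx addr0.
  by rewrite /tin (negbTE jl) scaler0.
rewrite /Xi; under eq_bigr do rewrite phiE raddf_sum.
rewrite exchange_big big1//= => q _.
set p := mkdual _; transitivity (rval (f (fr_b P (rdelta q))) p); last by rewrite fb rdual0.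
rewrite rv_linear_sum.
have ev : zmod_morphism (fun h : rdual (dual K) => rval h p) by move=> h h'; rewrite rdualB.
by rewrite -[RHS]/(mkadd ev _) raddf_sum.
Qed.

(** By [Xi_ker], [Xi] extends along [arow] to a character of (K^+)^k, whose coordinates are the
    values of [g] on the basis. *)
Lemma double_dual_extend :
  exists g : {linear 'rV[R]_(fr_k P) -> rdual (dual K)}, forall u, g (fr_a P u) = f u.
Proof.
have [Y YE] := @QZ_extend _ _ (mkadd arowB) (mkadd XiB) Xi_ker.
exists (rvlift (fun i => mkrdual (Y \o mkadd (@tin_additive (dual K) (fr_k P) i)))).
apply: (@rv_ext _ _ _ (rvlift _ \o fr_a P)) => l; apply: rdual_eqP => phi.
transitivity (Xi (tin l phi)); last first.
  exact: (tuple_sum_tin (fun l => rval (xi l))).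
rewrite -[RHS]YE -[X in rval X]/(rvlift _ (fr_a P (rdelta l))) rvliftE.
have ev : zmod_morphism (fun h : rdual (dual K) => rval h phi) by move=> h h'; rewrite rdualB.
rewrite -[LHS]/(mkadd ev _) raddf_sum /= [in RHS](tuple_sum (arow _)) raddf_sum.
apply: eq_bigr => i _; congr (Y (tin i _)).
rewrite /arow (bigD1 l)//= big1 => [|j jl]; first by rewrite /tin eqxx addr0.
by rewrite /tin (negbTE jl) scaler0.
Qed.

End DoubleDual.

Lemma FP_inj_dual_flat (R : pzRingType) (n : enat) (K : lmodType R) : gt1 n ->
  FP_inj n K -> FP_flat n (dual K).
Proof.
move=> n1 /FP_injP extK; apply/FP_flatP/FP_injP => F FPF.
have [P] := FP_free_pres n1 FPF; apply/(ext0_free_pres _ P) => f fb.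
exact: (double_dual_extend (extK F FPF) fb).
Qed.

Lemma inj_surj_bijective (A B : Type) (f : A -> B) :
  injective f -> surjective f -> bijective f.
Proof.
move=> inj surj; have [g gE] := choice surj; exists g => // x.
by apply: inj; rewrite gE.
Qed.

Section RightPerp.
Variables (R : pzRingType) (K : lmodType R -> Prop).

Lemma rperpP (Y : lmodType R) : rperp K Y <-> forall Z, K Z -> ext0 Z Y.
Proof. by split=> perp X /perp /Ext1P. Qed.

Lemma rperp_closed_summands : closed_summands (rperp K).
Proof.
move=> A B [C [h hbij]] /rperpP extB; apply/rperpP => Z KZ D E a p ex ps f kf.
have hinj : injective h by exact: bij_inj.
have [h' hh' h'h] := hbij.
have il : linear (fun x : A => (x, 0 : C)).
  by move=> r x y; congr (_, _); rewrite /= scaler0 addr0.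
have [d|g gE] := extB Z KZ D E a p ex ps (h \o mklin il \o f).
  by move=> /kf /= ->; rewrite -[RHS](linear0 h).
have [c|q qE] := @factor_mono _ _ _ _ h g hinj; first by exists (h' (g c)).
exists (fst \o q) => d /=.
have -> : q (a d) = (f d, 0) by apply: hinj; rewrite qE gE.
by [].
Qed.

Lemma rperp_closed_finite_sums : closed_finite_sums (rperp K).
Proof.
move=> k M S u /[dup] ubij [pr prK Kpr] KM; apply/rperpP => Z KZ D E a p ex ps f kf.
have prl i : linear (fun s => pr s i).
  move=> r s t; have -> : pr (r *: s + t) = fun i => r *: pr s i + pr t i.
    apply: (bij_inj ubij); rewrite Kpr.
    under eq_bigr do rewrite linearP.
    by rewrite big_split /= -scaler_sumr !Kpr.
  by [].
have ext i : exists g : {linear E -> M i}, forall d, g (a d) = mklin (prl i) (f d).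
  have /rperpP/(_ Z KZ) extM := KM i.
  apply: (extM _ _ _ _ ex ps (mklin (prl i) \o f)) => d /kf fd.
  by rewrite -[LHS]/(mklin (prl i) (f d)) fd linear0.
have gl : linear (fun e => \sum_i u i (projT1 (cid (ext i)) e)).
  move=> r x y; rewrite scaler_sumr -big_split; apply: eq_bigr => i _.
  by rewrite !linearP.
exists (mklin gl) => d /=; rewrite -[RHS]Kpr; apply: eq_bigr => i _.
by case: cid => /= g ->.
Qed.

End RightPerp.

(** * Balance of Ext and purity *)

Section Purity.
Variable R : pzRingType.
Implicit Types A B C M : lmodType R.

(* The hypothesis says Ext^1_R(M, N^+) = 0, the conclusion Ext^1(N, M^+) = 0;
   both express Tor_1^R(N, M) = 0. *)
Lemma ext0_balance (N : lmodType R^c) M : ext0 M (rdual N) -> ext0 N (dual M).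
Proof.
move=> extM D B a p ex ps f kf.
pose P := free R M; pose q : {linear P -> M} := free_lift (@id M).
have qs : surjective q by move=> x; exists (delta _ x); rewrite free_lift_delta.
(* Extending each character d |-> f d x to [B] gives g1 : P -> B^+ on the free cover of [M]. *)
have epsE x : exists eps : {additive B -> QZ}, forall d, eps (a d) = f d x.
  have fB : zmod_morphism (fun d => f d x) by move=> d d'; rewrite linearB dualB.
  apply: (@QZ_extend D B a (mkadd fB)) => d /kf fd.
  by rewrite -[LHS]/(dual_val (f d) x) fd.
pose g1 : {linear P -> rdual B} :=
  free_lift (fun x => mkrdual (projT1 (cid (epsE x)))).
have [f' f'E] := pairing_left f.
have g1E z d : rval (g1 z) (a d) = f d (q z).
  rewrite -f'E -rdual_mapE; congr (rval _ d).
  apply: (@free_ext _ _ _ (rdual_map a \o g1) (f' \o q)) => x.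
  apply: rdual_eqP => d'; rewrite -[LHS]/(rval (rdual_map a (g1 (delta R x))) d').
  rewrite rdual_mapE /g1 free_lift_delta mkrdualE -[RHS]/(rval (f' (q (delta R x))) d').
  by rewrite f'E /q free_lift_delta; case: cid.
pose K := ker_sm q.
have kerK k : q (sinc K k) = 0 by exact: (@sincP _ _ K).
(* On K = ker q, the values of [g1] vanish on the image of [D], so they come from N^+. *)
have [|k|th thE] := @factor_mono _ _ _ _ (rdual_map p) (g1 \o sinc K).
- move=> phi psi pp; apply: rdual_eqP => n; have [b <-] := ps n.
  by rewrite -!rdual_mapE pp.
- have [b /ex [d <-]|phi phiE] := @QZ_extend _ _ p (rval (g1 (sinc K k))).
    by rewrite g1E kerK raddf0.
  by exists (mkrdual phi); apply: rdual_eqP => b; rewrite rdual_mapE mkrdualE phiE.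
have [k k0|de deE] := extM _ _ _ _ (ker_exact q) qs th.
  by rewrite (_ : k = 0) ?linear0//; apply: (@sinc_inj _ _ K); rewrite k0 linear0.
(* [de] extends [th] to [P]; subtracting it from [g1] gives a map that kills [K] and descends to
   [M]. *)
have [z /(@sinc_surj _ _ K) [k <-]|G GE] :=
    @factor_epi _ _ _ _ q (g1 \- (rdual_map p \o de)) qs.
  by rewrite /= deE thE subrr.
have [g gE] := pairing_right G.
exists g => d; apply: dual_eqP => m; have [z <-] := qs m.
rewrite -gE GE -[LHS]/(rval (g1 z - rdual_map p (de z)) (a d)) rdualB g1E.
have pad : p (a d) = 0 by apply/ex; exists d.
by rewrite rdual_mapE pad raddf0 subr0.
Qed.

Section DualSequence.
Variables (A B C : lmodType R) (i : {linear A -> B}) (p : {linear B -> C}).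

Lemma dual_short_exact : short_exact i p -> short_exact (dual_map p) (dual_map i).
Proof.
move=> [iinj ip ps]; split=> [phi psi pp|phi|phi].
- by apply: dual_eqP => c; have [b <-] := ps c; rewrite -!dual_mapE pp.
- split=> [iphi|[psi <-]]; last first.
    apply: dual_eqP => a; rewrite !dual_mapE [p _](_ : _ = 0) ?raddf0//.
    by apply/ip; exists a.
  have [b /ip [a <-]|psi psiE] := @QZ_extend _ _ p phi.
    by rewrite -[LHS]/(dual_val phi (i a)) -dual_mapE iphi.
  by exists (mkdual psi); apply: dual_eqP => b; rewrite dual_mapE mkdualE psiE.
have [a ia|psi psiE] := @QZ_extend _ _ i phi.
  by rewrite (_ : a = 0) ?raddf0//; apply: iinj; rewrite ia linear0.
by exists (mkdual psi); apply: dual_eqP => a; rewrite dual_mapE mkdualE psiE.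
Qed.

Lemma pure_of_tensor_inj : short_exact i p ->
  (forall (N : lmodType R^c) (t : tensor N A), tmap N i t = 0 -> t = 0) ->
  pure_exact i p.
Proof.
move=> sip inj; split=> // N; have [_ ip ps] := sip.
have [ex surj] := tensor_right_exact N ip ps.
split=> // t u tu; apply/eqP; rewrite -subr_eq0; apply/eqP/(inj N).
by rewrite raddfB -[tmap N i t]/(tensor_map i t) tu subrr.
Qed.

(** Through [s] every character of N (x) A extends to N (x) B, so an element that dies in N (x) B is
    killed by all characters. *)
Lemma pure_of_dual_section (s : {linear dual A -> dual B}) : short_exact i p ->
  (forall phi, dual_map i (s phi) = phi) -> pure_exact i p.
Proof.
move=> sip sE; apply: pure_of_tensor_inj => // N t it; apply: contrapT => t0.
have [|chi [_ /eqP]] := @QZ_separate (tensor N A) (tensor N A) \0 t.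
  by move=> [s' /esym].
apply; have [h hE] := char_tensor chi; have [chi' chi'E] := tensor_char (s \o h).
transitivity (chi' (tmap N i t)); last by rewrite it raddf0.
apply: (@tensor_ext _ _ _ _ chi (chi' \o tmap N i)) => n x.
rewrite -[RHS]/(chi' (tmap N i (tens n x))) tmap_tens chi'E hE.
by rewrite -dual_mapE sE.
Qed.

(** Tensoring with A^+, the evaluation character of A^+ (x) A extends to A^+ (x) B; its adjoint is
    the section. *)
Lemma dual_section_of_pure : pure_exact i p ->
  exists s : {linear dual A -> dual B}, forall phi, dual_map i (s phi) = phi.
Proof.
move=> [_ /(_ (dual A)) [inj _ _]].
have [chi chiE] := @tensor_char _ (dual A) A idfun.
have [t it|chi' chi'E] := @QZ_extend _ _ (tmap (dual A) i) chi.
  rewrite (_ : t = 0) ?raddf0//; apply: inj.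
  by rewrite -!tmapE it raddf0.
have [s sE] := char_tensor chi'; exists s => phi; apply: dual_eqP => x.
by rewrite dual_mapE -sE -tmap_tens chi'E chiE.
Qed.

End DualSequence.

(** A tensor over the kernel involves finitely many elements of it. A map [r'] from [B] to the
    kernel fixing these recovers the tensor from its image. *)
Lemma locally_split_pure B C (g : {linear B -> C}) :
  locally_split_epi g -> pure_exact (sinc (ker_sm g)) g.
Proof.
move=> [gs gsp]; pose K := ker_sm g; apply: pure_of_tensor_inj => [|N t it].
  by split; [exact: sinc_inj|exact: ker_exact|].
have [s sE] := tensor_decomp t.
have [|r [gr rE]] := gsp _ (fun j => sinc K (tnth (in_tuple s) j).2).
  by move=> j; exact: (@sincP _ _ K).
have [|b|r' r'E] := @factor_mono _ _ _ _ (sinc K) r.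
- exact: sinc_inj.
- by apply: (@sinc_surj _ _ K).
transitivity (tmap N r' (tmap N (sinc K) t)); last by rewrite it raddf0.
rewrite {1 2}sE big_tnth !raddf_sum; apply: eq_bigr => j _.
rewrite !tmap_tens; congr (tens _ _).
by apply: (@sinc_inj _ _ K); rewrite r'E rE.
Qed.

End Purity.

(** * Duality pairs and pure quotients *)

Section Equivalence.
Variables (R : pzRingType) (n : enat).
Hypothesis n1 : gt1 n.

Lemma pure_quotients_of_duality_pair (X : lmodType R -> Prop) (Y : lmodType R^c -> Prop) :
  duality_pair X Y -> closed_pure_quotients X.
Proof.
move=> [XY sumY _] A B C f g pure /XY YB; apply/XY; apply: (sumY _ (dual B)) => //.
have [s sE] := dual_section_of_pure pure; have [sfg _] := pure.
have [ginj gf _] := dual_short_exact sfg.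
exists (dual A), (pairlin (dual_map g) s); apply: inj_surj_bijective.
- have ker x : pairlin (dual_map g) s x = 0 -> x = 0.
    case: x => [ga phi] /= e.
    have phi0 : phi = 0.
      rewrite -(sE phi) -[s phi](addKr (dual_map g ga)) e addr0 linearN.
      by rewrite (_ : dual_map f _ = 0) ?oppr0//; apply/gf; exists ga.
    rewrite phi0 linear0 addr0 in e *.
    by congr (_, _); apply: ginj; rewrite e linear0.
  move=> x y xy; apply/eqP; rewrite -subr_eq0; apply/eqP/ker.
  by rewrite linearB xy subrr.
- move=> psi; have /gf [ga gaE] : dual_map f (psi - s (dual_map f psi)) = 0.
    by rewrite linearB sE subrr.
  by exists (ga, dual_map f psi); rewrite /= gaE subrK.
Qed.

Lemma duality_pair_of_pure_quotients :
  closed_pure_quotients (lperp (@FP_inj R n)) ->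
  duality_pair (lperp (@FP_inj R n)) (rperp (@FP_flat R n)).
Proof.
move=> closed; split=> [M||]; last 2 first.
- exact: rperp_closed_summands.
- exact: rperp_closed_finite_sums.
split=> [/lperpP extM|/rperpP extM].
  apply/rperpP => N /FP_flatP injN; apply: ext0_balance; exact: extM.
have [B [L [i [p [sip injB perpL]]]]] := special_precover n1 M.
apply: (closed B L M i p) => //.
have extB := extM _ (FP_inj_dual_flat n1 injB).
have [pinj ip isurj] := dual_short_exact sip.
have [|r rE] := extB _ _ _ _ ip isurj idfun.
  by move=> d d0; apply: pinj; rewrite d0 linear0.
(* As [r] is a retraction of [dual_map p], this difference kills the kernel of [dual_map i] and
   descends to a section of it. *)
have kr (x : dual L) : dual_map i x = 0 -> (idfun \- (dual_map p \o r)) x = 0.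
  by move=> /ip [d <-] /=; rewrite rE subrr.
have [s sE] := factor_epi isurj kr.
apply: (@pure_of_dual_section _ _ _ _ _ _ s sip) => phi; have [x <-] := isurj phi.
rewrite sE /= linearB [X in _ - X](_ : _ = 0) ?subr0//.
by apply/ip; exists (r x).
Qed.

End Equivalence.

(** * Envelopes *)

Section WellOrder.

Lemma well_order_exists (T : Type) : exists lt : T -> T -> Prop,
  [/\ well_founded lt, forall i j k, lt i j -> lt j k -> lt i k &
      forall i j, i = j \/ lt i j \/ lt j i].
Proof.
have [le wo] := wochoice.well_ordering_principle {classic T}.
have wc : wochoice.wo_chain le predT by move=> A _; exact: wo.
have tot i j : le i j || le j i by exact: (wochoice.wo_chainW wc).
have anti i j : le i j -> le j i -> i = j.
  by move=> ij ji; apply: (wochoice.wo_chain_antisymmetric wc) => //; rewrite ij ji.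
have min (A : T -> Prop) x : A x -> exists2 m, A m & forall y, A y -> le m y.
  move=> Ax; have [|m [[/asboolP Am lb] _]] := wo (fun y : {classic T} => `[< A y >]).
    by exists x; apply/asboolP.
  by exists m => // y Ay; apply: lb; apply/asboolP.
exists (fun i j => le i j /\ i <> j); split.
- move=> x; apply: contrapT => nx.
  have [m nm lb] := min (fun y => ~ Acc _ y) x nx.
  apply: nm; constructor => y [ym yNm]; apply: contrapT => /lb my.
  by apply: yNm; apply: anti.
- move=> i j k [ij iNj] [jk jNk]; split; last first.
    by move=> ik; rewrite -ik in jk; apply: iNj; apply: anti.
  (* The least element among i, j, k can only be i. *)
  have [|m [|[|]] -> lb] := min (fun y => y = i \/ y = j \/ y = k) i; first by left.
  + by apply: lb; right; right.
  + by case: iNj; apply: anti => //; apply: lb; left.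
  + by case: jNk; apply: anti => //; apply: lb; right; left.
- move=> i j; have [->|ij] := pselect (i = j); first by left.
  right; have /orP[le_ij|le_ji] := tot i j; [left|right]; split=> //.
  by move=> ji; apply: ij.
Qed.

(** Recursion with choice: [P k] depends only on values below [k], so the function built so far may
    be completed by [x0]. *)
Lemma well_founded_choice (I X : Type) (x0 : X) (lt : I -> I -> Prop)
    (P : I -> (I -> X) -> X -> Prop) :
  well_founded lt ->
  (forall k G G' x, (forall j, lt j k -> G j = G' j) -> P k G x -> P k G' x) ->
  (forall k G, exists x, P k G x) -> exists F, forall k, P k F (F k).
Proof.
move=> wf ext tot.
pose ex k (rec : forall j, lt j k -> X) j : X :=
  if pselect (lt j k) is left h then rec j h else x0.
pose step k rec := projT1 (cid (tot k (ex k rec))).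
have stepE k rec rec' : (forall j h, rec j h = rec' j h) -> step k rec = step k rec'.
  move=> rr; congr step; apply: functional_extensionality_dep => j.
  exact: functional_extensionality_dep.
exists (Fix wf _ step) => k; rewrite Fix_eq //.
apply: (ext _ (ex k (fun j _ => Fix wf _ step j))).
  by move=> j jk; rewrite /ex; case: pselect.
by rewrite /step; case: cid.
Qed.

Lemma cantor (T : Type) (f : (T -> Prop) -> T) : ~ injective f.
Proof.
move=> inj; pose D x := exists A, f A = x /\ ~ A x.
have nD : ~ D (f D) by move=> DfD; have [A [/inj -> nDD]] := DfD; exact: nDD.
by apply: (nD); exists D.
Qed.

End WellOrder.

(** * Direct limits of special preenvelopes *)

Section Envelopes.
Variables (R : pzRingType) (n : enat).
Hypothesis n1 : gt1 n.
Hypothesis closed : closed_pure_quotients (lperp (@FP_inj R n)).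
Implicit Types M V W L : lmodType R.

(** In an extension of the direct sum each inclusion lifts, and the lifts add up to a section. *)
Lemma lperp_dsum (I : Type) (V : I -> lmodType R) :
  (forall i, lperp (@FP_inj R n) (V i)) -> lperp (@FP_inj R n) (dsum V).
Proof.
move=> perpV; apply/lperpP => X injX; apply: ext0_split => E j p sp.
have lift i : exists w : {linear V i -> E}, forall v, p (w v) = din i v.
  have extV : ext0 (V i) X by move/lperpP: (perpV i); apply.
  (* With R^0 as the zero submodule, [ext0_lifting] lifts a map from all of V i. *)
  have s0 : short_exact (\0 : {linear 'rV[R]_0 -> V i}) idfun.
    split=> [x y _|y|y]; last by exists y.
      by apply/rowP => -[].
    by split=> [/= ->|[x <-]//]; exists 0.
  have [|w [_ wE]] := @ext0_lifting _ _ _ _ _ _ _ _ _ j p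
      (\0 : {linear 'rV[R]_0 -> E}) (din i) extV s0 sp.
    by move=> a; rewrite /= !linear0.
  by exists w.
pose w := dlift (fun i => projT1 (cid (lift i))).
have pw x : p (w x) = x.
  apply: (@dsum_ext _ _ _ _ (p \o w) idfun) => i v /=.
  by rewrite dlift_din; case: cid.
apply: (@retract_of_section _ _ _ _ _ idfun j p w) => // [y|b /= ->].
  by exists y.
exact: linear0.
Qed.

(** The obstruction lies in Ext^1(W/M, E) = 0. *)
Lemma special_extend M W (E : lmodType R) (phi : {linear M -> W}) (psi : {linear M -> E}) :
  special n phi -> FP_inj n E -> exists h : {linear W -> E}, forall x, h (phi x) = psi x.
Proof.
move=> [phinj _ /lperpP perp] injE.
apply: (perp E injE _ _ phi (qpi (im_sm phi))).
- exact: coker_exact.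
- exact: qpi_surj.
by move=> d d0; rewrite (_ : d = 0) ?linear0//; apply: phinj; rewrite d0 linear0.
Qed.

Definition endo_under M W (phi : {linear M -> W}) (f : {linear W -> W}) : Prop :=
  forall x, f (phi x) = phi x.

(** The limit is a locally split quotient of a direct sum of copies of [W]. Its cokernel is the
    limit of copies of W/M, hence a pure quotient of their direct sum, where [closed] applies. *)
Lemma special_colimit (I : Type) (le : I -> I -> Prop) (i0 : I) M W
    (phi : {linear M -> W}) (f : I -> I -> {linear W -> W}) :
  (forall i, le i i) -> (forall i j k, le i j -> le j k -> le i k) ->
  (forall i j, exists k, le i k /\ le j k) ->
  (forall i x, f i i x = x) ->
  (forall i j k x, le i j -> le j k -> f j k (f i j x) = f i k x) ->
  special n phi -> (forall i j, le i j -> endo_under phi (f i j)) ->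
  exists L (u : I -> {linear W -> L}) (phi' : {linear M -> L}),
    [/\ is_colimit le f u, special n phi' & forall i x, u i (phi x) = phi' x].
Proof.
move=> le_refl le_trans le_dir f_id f_comp [phinj injW perpW] fphi.
have [L [u colim]] := colimit_exists le_refl le_trans le_dir i0 f_id f_comp.
have [coh gen ker] := colim.
have uphi i x : u i (phi x) = u i0 (phi x).
  have [k [ik jk]] := le_dir i i0.
  by rewrite -(coh i k _ ik) -(coh i0 k _ jk) !fphi.
pose phi' : {linear M -> L} := u i0 \o phi.
exists L, u, phi'; split=> //; split.
- move=> x y xy; have [|k [i0k xyk]] := ker i0 (phi (x - y)).
    by rewrite !linearB; apply/eqP; rewrite subr_eq0; apply/eqP.
  move: xyk; rewrite fphi// linearB => /eqP; rewrite subr_eq0 => /eqP.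
  exact: phinj.
- apply: (FP_inj_locally_split n1 (colimit_locally_split le_trans le_dir i0 f_comp colim)).
  exact: FP_inj_dsum.
pose A := quotm (im_sm phi); pose q := qpi (im_sm phi); pose q' := qpi (im_sm phi').
have qphi x : q (phi x) = 0 by apply/qpi0; exists x.
have gex i j : exists g : {linear A -> A}, le i j -> forall x, g (q x) = q (f i j x).
  have [ij|nij] := pselect (le i j); last by exists idfun.
  have [x /qpi0 [m <-]|g gE] := @factor_epi _ _ _ _ q (q \o f i j) (@qpi_surj _ _ _).
    by rewrite /= fphi.
  by exists g.
pose g i j := projT1 (cid (gex i j)).
have gE i j x : le i j -> g i j (q x) = q (f i j x).
  by move=> ij; rewrite /g; case: cid => /= h; apply.
have vex i : exists v : {linear A -> quotm (im_sm phi')}, forall x, v (q x) = q' (u i x).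
  have [x /qpi0 [m <-]|v vE] := @factor_epi _ _ _ _ q (q' \o u i) (@qpi_surj _ _ _).
    by rewrite /= uphi; apply/qpi0; exists m.
  by exists v.
pose v i := projT1 (cid (vex i)).
have vE i x : v i (q x) = q' (u i x) by rewrite /v; case: cid.
have colimA : is_colimit le g v.
  split=> [i j a ij|z|i a].
  - by have [x <-] := qpi_surj a; rewrite gE// !vE coh.
  - by have [y <-] := qpi_surj z; have [i [x ->]] := gen y; exists i, (q x); rewrite vE.
  - have [x <-] := qpi_surj a; rewrite vE => /qpi0 [m mE].
    have [|j [ij xj]] := ker i (x - phi m).
      by rewrite linearB uphi; apply/eqP; rewrite subr_eq0; apply/eqP/esym.
    exists j; split=> //; rewrite gE//.
    move: xj; rewrite linearB fphi// => /eqP; rewrite subr_eq0 => /eqP ->.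
    exact: qphi.
have g_comp i j k a : le i j -> le j k -> g j k (g i j a) = g i k a.
  move=> ij jk; have [x <-] := qpi_surj a.
  by rewrite !gE ?f_comp//; apply: le_trans jk.
have := locally_split_pure (colimit_locally_split le_trans le_dir i0 g_comp colimA).
by move/closed; apply; apply: lperp_dsum.
Qed.

(** * Transfinite towers of endomorphisms *)

Section Towers.
Variables (M W : lmodType R) (phi : {linear M -> W}).
Hypothesis sphi : special n phi.
Variables (I : Type) (lt : I -> I -> Prop).
Hypothesis lt_wf : well_founded lt.
Hypothesis lt_trans : forall i j k, lt i j -> lt j k -> lt i k.
Hypothesis lt_total : forall i j, i = j \/ lt i j \/ lt j i.

Lemma lt_irr i : ~ lt i i.
Proof. by elim/(well_founded_ind lt_wf): i => i ih ii; apply: (ih i). Qed.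

(* [F j i], for i < j, is the transition map from stage i to stage j. *)
Definition coherent_on (D : I -> Prop) (F : I -> I -> {linear W -> W}) : Prop :=
  (forall i j, D i -> D j -> lt i j -> endo_under phi (F j i)) /\
  (forall i j k x, D i -> D j -> D k -> lt i j -> lt j k -> F k j (F j i x) = F k i x).

Definition cocone_on (D : I -> Prop) (F : I -> I -> {linear W -> W})
    (c : I -> {linear W -> W}) : Prop :=
  (forall i, D i -> endo_under phi (c i)) /\
  (forall i j x, D i -> D j -> lt i j -> c j (F j i x) = c i x).

(** The limit over [D] is again special under [M], so it maps back to [W] under [M]; the cocone
    consists of the composites. *)
Lemma cocone_exists D F i0 : D i0 -> coherent_on D F -> exists c, cocone_on D F c.
Proof.
move=> Di0 [Fphi Fcomp].
pose J := {i | D i}.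
pose le (i j : J) := sval i = sval j \/ lt (sval i) (sval j).
pose f (i j : J) : {linear W -> W} :=
  if pselect (sval i = sval j) is left _ then idfun else F (sval j) (sval i).
have f_eq (i j : J) x : sval i = sval j -> f i j x = x by rewrite /f; case: pselect.
have f_lt (i j : J) x : lt (sval i) (sval j) -> f i j x = F (sval j) (sval i) x.
  by rewrite /f; case: pselect => // ->  /lt_irr.
have [||||||L [u [phi' [colim sphi' uphi]]]] :=
    @special_colimit J le (exist _ i0 Di0) M W phi f _ _ _ _ _ sphi.
- by move=> i; left.
- move=> i j k [ij|ij] [jk|jk]; rewrite /le.
  + by left; rewrite ij.
  + by right; rewrite ij.
  + by right; rewrite -jk.
  + by right; apply: lt_trans jk.
- move=> i j; have [ij|[ij|ji]] := lt_total (sval i) (sval j).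
  + by exists j; split; left.
  + by exists j; split; [right|left].
  + by exists i; split; [left|right].
- by move=> i x; apply: f_eq.
- move=> i j k x [ij|ij] [jk|jk].
  + by rewrite !f_eq// ij.
  + by rewrite (f_eq i j)// !f_lt ?ij.
  + by rewrite (f_eq j k)// !f_lt -?jk.
  + rewrite !f_lt//; last exact: lt_trans jk.
    by apply: Fcomp => //; [exact: svalP i|exact: svalP j|exact: svalP k].
- move=> i j [ij|ij] x; first exact: f_eq.
  by rewrite f_lt//; apply: Fphi => //; [exact: svalP i|exact: svalP j].
have [coh _ _] := colim.
have [_ injW _] := sphi; have [h hE] := special_extend phi sphi' injW.
pose c i : {linear W -> W} :=
  if pselect (D i) is left Di then h \o u (exist _ i Di) else idfun.
exists c; rewrite /c.
split=> [i Di x|i j x Di Dj ij]; first by case: pselect => // Di' /=; rewrite uphi hE.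
case: pselect => // Dj'; case: pselect => // Di' /=; congr (h _).
by rewrite -(coh (exist _ i Di') (exist _ j Dj')) ?f_lt//; right.
Qed.

(** Progress in one step: below, either g kills something more after f, or g is not surjective. *)
Variable S : {linear W -> W} -> {linear W -> W} -> Prop.
Hypothesis stepS : forall f, endo_under phi f -> exists2 g, endo_under phi g & S f g.
Variable i0 : I.
Hypothesis i0_min : forall i, ~ lt i i0.

(** A cocone [c] on the earlier stages is followed by a map [g] making progress over the map from
    the bottom stage. *)
Definition stage_on k (F : I -> I -> {linear W -> W}) (h : I -> {linear W -> W}) : Prop :=
  exists c g, [/\ cocone_on (lt^~ k) F c, endo_under phi g, S (c i0) g &
    forall i x, lt i k -> h i x = g (c i x)].

Lemma tower_exists : exists F : I -> I -> {linear W -> W},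
  coherent_on (fun=> True) F /\ forall k, lt i0 k -> stage_on k F (F k).
Proof.
(* Coherence below [k] is a premise, so that the recursion is total; [key] establishes it afterwards
   by induction. *)
pose P k (F : I -> I -> {linear W -> W}) (h : I -> {linear W -> W}) :=
  coherent_on (lt^~ k) F -> lt i0 k -> stage_on k F h.
have [k G G' h GG' PG|k G|F PF] :=
  @well_founded_choice I (I -> {linear W -> W}) (fun=> idfun) lt P lt_wf.
- move=> [coh1 coh2] i0k; have [|//|c [g [[c1 c2] gphi Sg hE]]] := PG.
    split=> [i j ik jk|i j l x ik jk lk].
      by rewrite (GG' j jk); apply: coh1.
    by rewrite (GG' j jk) (GG' l lk); apply: coh2.
  exists c, g; split=> //; split=> // i j x ik jk ij.
  by rewrite -(GG' j jk); apply: c2.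
- have [coh|ncoh] := pselect (coherent_on (lt^~ k) G); last by exists (fun=> idfun).
  have [i0k|ni0k] := pselect (lt i0 k); last by exists (fun=> idfun).
  have [c cP] := cocone_exists i0k coh; have [cphi _] := cP.
  have [g gphi Sg] := stepS (cphi i0 i0k).
  by exists (fun i => g \o c i : {linear W -> W}) => _ _; exists c, g.
have key k : (forall i, lt i k -> endo_under phi (F k i)) /\
    (forall i j x, lt i j -> lt j k -> F k j (F j i x) = F k i x).
  elim/(well_founded_ind lt_wf): k => k ih.
  have [i0k|ni0k] := pselect (lt i0 k); last first.
    have none i : ~ lt i k.
      move=> ik; have [e|[//|ki0]] := lt_total i0 k; last exact: (i0_min ki0).
      by apply: (@i0_min i); rewrite e.
    by split=> [i /none//|i j x _ /none].
  have [|c [g [[c1 c2] gphi _ hE]]] := PF k _ i0k.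
    split=> [i j _ jk ij|i j l x _ _ lk ij jl].
      by have [+ _] := ih j jk; apply.
    by have [_ +] := ih l lk; apply.
  split=> [i ik x|i j x ij jk]; first by rewrite hE// c1.
  by rewrite !hE ?c2//; apply: lt_trans jk.
exists F; split=> [|k i0k].
  split=> [i j _ _ ij|i j k x _ _ _ ij jk]; first by have [+ _] := key j; apply.
  by have [_ +] := key k; apply.
apply: PF => //; split=> [i j _ _ ij|i j l x _ _ _ ij jl].
  by have [+ _] := key j; apply.
by have [_ +] := key l; apply.
Qed.

End Towers.

End Envelopes.

(** * Existence of envelopes *)

Section EnvelopeExistence.
Variables (R : pzRingType) (n : enat).
Hypothesis n1 : gt1 n.
Hypothesis closed : closed_pure_quotients (lperp (@FP_inj R n)).
Implicit Types M W : lmodType R.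

Lemma well_order_min (I : Type) (lt : I -> I -> Prop) : inhabited I -> well_founded lt ->
  exists i0, forall i, ~ lt i i0.
Proof.
move=> [i] wf; apply: contrapT => none.
elim/(well_founded_ind wf): i => i ih; apply: none; exists i => j ji.
exact: (ih j ji).
Qed.

(* Otherwise kernels grow strictly along a tower indexed by a well-ordered set
   with more elements than W has subsets. *)
Lemma maximal_kernel M W (phi : {linear M -> W}) : special n phi ->
  exists2 f, endo_under phi f & forall g, endo_under phi g -> forall x, g (f x) = 0 -> f x = 0.
Proof.
move=> sphi; apply: contrapT => none.
pose S (f g : {linear W -> W}) := exists2 x, g (f x) = 0 & f x <> 0.
have stepS f : endo_under phi f -> exists2 g, endo_under phi g & S f g.
  move=> fphi; apply: contrapT => ng; apply: none; exists f => // g gphi x gfx.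
  by apply: contrapT => fx; apply: ng; exists g => //; exists x.
pose I : Type := (W -> Prop) -> Prop.
have [lt [wf tr tot]] := well_order_exists I.
have [i0 i0min] := well_order_min (inhabits (fun=> True) : inhabited I) wf.
have [F [[Fphi Fcomp] FS]] := tower_exists n1 closed sphi wf tr tot stepS i0min.
have low k : i0 = k \/ lt i0 k by have [|[|/i0min]] := tot i0 k; tauto.
(* The kernel of the map from stage [i0] to stage [k]; at k = i0 that map is the identity. *)
pose K k x := if pselect (lt i0 k) then F k i0 x = 0 else x = 0.
have KE k x : lt i0 k -> K k x = (F k i0 x = 0) by rewrite /K; case: pselect.
have Kinc i k : lt i k -> exists x, K k x /\ ~ K i x.
  move=> ik; have i0k : lt i0 k by have [->//|i0i] := low i; apply: tr ik.
  have [c [g [[_ cF] _ [x gx cx] FE]]] := FS k i0k.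
  (* The [x] supplied by [S] survives at stage [i], because [c i0] factors through the map to that
     stage. *)
  exists x; rewrite KE// FE//; split=> //.
  have [ei|i0i] := low i; last first.
    by rewrite KE// => Fx; apply: cx; rewrite -(cF i0 i)// Fx linear0.
  move=> Kx; apply: cx; rewrite (_ : x = 0) ?linear0//.
  by move: Kx; rewrite /K -ei; case: pselect => // ii; case: (i0min _ ii).
apply: (@cantor (W -> Prop) K) => i k ik.
by have [//|[/Kinc|/Kinc]] := tot i k; rewrite ik => -[x []].
Qed.

Fixpoint iterlin W (f : {linear W -> W}) (k : nat) : {linear W -> W} :=
  if k is k'.+1 then f \o iterlin f k' else idfun.

Lemma iterlin_add W (f : {linear W -> W}) k l x :
  iterlin f (k + l) x = iterlin f k (iterlin f l x).
Proof. by elim: k => //= k ->. Qed.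

(** An element killed by [h] has the form u (i+1) (f z). Composing u (i+1), [h] and a map back to
    [W] gives an endomorphism under [M] killing f z, so f z = 0 by maximality of ker f. *)
Lemma mono_special M : exists (V : lmodType R) (phi : {linear M -> V}),
  special n phi /\ forall h, endo_under phi h -> injective h.
Proof.
have [W [phi sphi]] := special_preenvelope n1 M.
have [f fphi fmax] := maximal_kernel sphi.
pose le := fun i j : nat => (i <= j)%N : Prop.
have dir i j : exists k, le i k /\ le j k.
  by exists (maxn i j); rewrite /le leq_maxl leq_maxr.
have tran i j k : le i j -> le j k -> le i k by exact: leq_trans.
have [|||V [u [phi' [colim sphi' uphi]]]] := @special_colimit R n n1 closed nat le 0 M W phi
  (fun i j => iterlin f (j - i)) leqnn tran dir _ _ sphi.
- by move=> i x; rewrite subnn.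
- move=> i j k x ij jk; rewrite -iterlin_add; congr (iterlin f _ x).
  by rewrite addnBA// subnK.
- by move=> i j _ x; elim: (j - i)%N => //= k ->; exact: fphi.
have [coh gen _] := colim.
exists V, phi'; split=> // h hphi x y xy; apply/eqP; rewrite -subr_eq0; apply/eqP.
have : h (x - y) = 0 by rewrite linearB xy subrr.
have [i [z ->]] := gen (x - y); move=> hz.
have [_ injW _] := sphi; have [e eE] := special_extend phi sphi' injW.
have uf : u i z = u i.+1 (f z).
  by rewrite -(coh i i.+1 z (leqnSn i)) subSnn.
have fz : f z = 0.
  apply: (fmax (e \o h \o u i.+1)) => [w|] /=; first by rewrite uphi hphi eE.
  by rewrite -uf hz linear0.
by rewrite uf fz linear0.
Qed.

(** A non-surjective [h0] serves as every step of a tower. A cocone over the whole tower has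
    injective components, so their images in [V] are distinct, contradicting Cantor's theorem. *)
Lemma mono_special_surj M (V : lmodType R) (phi : {linear M -> V}) : special n phi ->
  (forall h, endo_under phi h -> injective h) -> forall h, endo_under phi h -> surjective h.
Proof.
move=> sphi mono h0 h0phi; apply: contrapT => h0ns.
pose S (f g : {linear V -> V}) := ~ surjective g.
have stepS f : endo_under phi f -> exists2 g, endo_under phi g & S f g by exists h0.
pose I : Type := (V -> Prop) -> Prop.
have [lt [wf tr tot]] := well_order_exists I.
have [i0 i0min] := well_order_min (inhabits (fun=> True) : inhabited I) wf.
have [F [Fcoh FS]] := tower_exists n1 closed sphi wf tr tot stepS i0min.
have [c [cphi cF]] :=
  cocone_exists n1 closed sphi wf tr tot (D := fun=> True) (i0 := i0) Logic.I Fcoh.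
pose K k y := exists x, c k x = y.
have Kinc i k : lt i k -> exists x, K k x /\ ~ K i x.
  move=> ik; have i0k : lt i0 k.
    by have [->//|[i0i|/i0min//]] := tot i0 i; apply: tr ik.
  have [c' [g [_ _ gns FE]]] := FS k i0k.
  have [y yg] : exists y, forall x, g x <> y.
    apply: contrapT => ny; apply: gns => y; apply: contrapT => nx; apply: ny.
    by exists y => x gx; apply: nx; exists x.
  exists (c k y); split=> [|[x]]; first by exists y.
  rewrite -(cF i k)// => /(mono _ (cphi k Logic.I)) Fx.
  by apply: (yg (c' i x)); rewrite -FE.
apply: (@cantor (V -> Prop) K) => i k ik.
by have [//|[/Kinc|/Kinc]] := tot i k; rewrite ik => -[x []].
Qed.

Lemma FP_inj_enveloping : enveloping (@FP_inj R n).
Proof.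
move=> M; have [V [phi [sphi mono]]] := mono_special M.
exists V, phi; split=> [|h hphi].
  split; first by have [] := sphi.
  by move=> E psi injE; exact: special_extend psi sphi injE.
apply: inj_surj_bijective; first exact: mono.
exact: (mono_special_surj sphi mono).
Qed.

End EnvelopeExistence.

Theorem proposition3p6 (R : pzRingType) (n : enat) (n_gt1 : gt1 n) :
  (closed_pure_quotients (lperp (@FP_inj R n)) <->
   duality_pair (lperp (@FP_inj R n)) (rperp (@FP_flat R n))) /\
  (closed_pure_quotients (lperp (@FP_inj R n)) /\
   duality_pair (lperp (@FP_inj R n)) (rperp (@FP_flat R n)) ->
   enveloping (@FP_inj R n)).
Proof.
split=> [|[closed _]]; last exact: FP_inj_enveloping.
split; first exact: duality_pair_of_pure_quotients.
exact: pure_quotients_of_duality_pair.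
Qed.
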